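(* If the image reflection series in the energy $U^{\text c}$ is truncated at $l=M$ (i.e. $\sum_{l=1}^\infty$ is replaced by $\sum_{l=1}^M$), the resulting $U^{\text c}_M$ is an approximation of $U^{\text c}$ with truncation error $$|U^{\text c}-U^{\text c}_M|=\mathcal O\!\left(|\gamma_{\text{top}}|^{\lfloor\frac{M+1}{2}\rfloor}\,|\gamma_{\text{bot}}|^{\lceil\frac{M+1}{2}\rceil}\,e^{-\frac{2\pi H(M-1)}{\max\{L_x,L_y\}}}\right).$$
   Context: Setting (three-layer sandwich model): $L_x,L_y,H>0$. $N$ point charges $q_1,\dots,q_N\in\mathbb R$ with charge neutrality $\sum_iq_i=0$ lie at positions $\boldsymbol r_i=(x_i,y_i,z_i)$ inside the central layer ($0<z_i<H$); the system is periodic in $x,y$ with periods $L_x,L_y$. Dielectric interfaces lie at $z=0$ and $z=H$, with permittivities $\varepsilon_{\text{top}},\varepsilon_{\text c},\varepsilon_{\text{bot}}$ in the top, central and bottom layers, and $$\gamma_{\text{top}}=\frac{\varepsilon_{\text c}-\varepsilon_{\text{top}}}{\varepsilon_{\text c}+\varepsilon_{\text{top}}},\qquad \gamma_{\text{bot}}=\frac{\varepsilon_{\text c}-\varepsilon_{\text{bot}}}{\varepsilon_{\text c}+\varepsilon_{\text{bot}}},\qquad |\gamma_{\text{top}}|\le1,\ |\gamma_{\text{bot}}|\le 1 .$$ For $l\ge1$ the $l$-th order image charges of $q_j$ have positions $\boldsymbol r_{j\pm}^{(l)}=(x_j,y_j,z_{j\pm}^{(l)})$ with $$z_{j+}^{(l)}=(-1)^lz_j+2\lceil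 l/2\rceil H,\qquad z_{j-}^{(l)}=(-1)^lz_j-2\lfloor l/2\rfloor H,$$ and factors $\gamma_+^{(l)}=\gamma_{\text{top}}^{\lceil l/2\rceil}\gamma_{\text{bot}}^{\lfloor l/2\rfloor}$ and $\gamma_-^{(l)}=\gamma_{\text{top}}^{\lfloor l/2\rfloor}\gamma_{\text{bot}}^{\lceil l/2\rceil}$. With $\boldsymbol r_{ij}=\boldsymbol r_i-\boldsymbol r_j$, $\boldsymbol n=(n_x,n_y)\in\mathbb Z^2$ and $\boldsymbol\ell=(n_xL_x,n_yL_y,0)$, the energy is $$U^{\text c}=\frac12\sum_{i,j=1}^Nq_iq_j\left[\sum_{\boldsymbol n}{}^{'}\frac1{|\boldsymbol r_{ij}+\boldsymbol\ell|}+\sum_{\boldsymbol n}\sum_{l=1}^\infty\left(\frac{\gamma_+^{(l)}}{|\boldsymbol r_i-\boldsymbol r_{j+}^{(l)}+\boldsymbol\ell|}+\frac{\gamma_-^{(l)}}{|\boldsymbol r_i-\boldsymbol r_{j-}^{(l)}+\boldsymbol\ell|}\right)\right],$$ where $'$ means the term $i=j$, $\boldsymbol n=\boldsymbol 0$ is omitted. The lattice sums are understood under neutrality: for each order $l$ and each $\boldsymbol n$ one sums over $i,j$ first, which makes the sum over $\boldsymbol n$ convergent. The $\mathcal O(\cdot)$ is with respect to the truncation level $M\to\infty$, with the particle configuration and all other parameters ($L_x,L_y,H,\gamma_{\text{top}},\gamma_{\text{bot}}$) fixed. *)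

(* Defs.v *)
From HB Require Import structures.
From mathcomp Require Import all_boot all_order all_algebra.
From mathcomp Require Import all_classical all_reals all_analysis.
From mathcomp.analysis.showcase Require summability.

Set Implicit Arguments.
Unset Strict Implicit.
Unset Printing Implicit Defensive.

Import Order.TTheory GRing.Theory Num.Theory.
Import numFieldNormedType.Exports.

Local Open Scope classical_set_scope.
Local Open Scope ring_scope.

Record sandwich (R : realType) (N : nat) := Sandwich {
  Lx : R;
  Ly : R;
  H : R;
  eps_top : R;
  eps_c : R;
  eps_bot : R;
  qval : 'I_N -> R;
  xpos : 'I_N -> R;
  ypos : 'I_N -> R;
  zpos : 'I_N -> R
}.

Section Energy.
Context {R : realType} {N : nat}.
Variable S : sandwich R N.

Definition gamma_top : R := (eps_c S - eps_top S) / (eps_c S + eps_top S).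
Definition gamma_bot : R := (eps_c S - eps_bot S) / (eps_c S + eps_bot S).

(* [l./2] is the floor and [uphalf l] the ceiling of l / 2. *)
Definition z_plus (l : nat) (j : 'I_N) : R :=
  (-1) ^+ l * zpos S j + 2 * (uphalf l)%:R * H S.
Definition z_minus (l : nat) (j : 'I_N) : R :=
  (-1) ^+ l * zpos S j - 2 * (l./2)%:R * H S.

Definition gamma_plus (l : nat) : R :=
  gamma_top ^+ uphalf l * gamma_bot ^+ l./2.
Definition gamma_minus (l : nat) : R :=
  gamma_top ^+ l./2 * gamma_bot ^+ uphalf l.

(* Distance between r_i translated by the lattice vector of index [n] and the
   point (x_j, y_j, z). The norm of the library on row vectors is the sup norm,
   hence the explicit Euclidean norm. *)
Definition lattice_dist (n : int * int) (i j : 'I_N) (z : R) : R :=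
  Num.sqrt ((xpos S i - xpos S j + n.1%:~R * Lx S) ^+ 2
          + (ypos S i - ypos S j + n.2%:~R * Ly S) ^+ 2
          + (zpos S i - z) ^+ 2).

(* Unordered sum over the lattice: the limit of the finite partial sums along
   the finite subsets of Z^2 directed by inclusion. Without neutrality the
   lattice sums diverge, so the sum over i, j is always taken inside. *)
Definition lattice_sum (f : int * int -> R) : R :=
  summability.sum (R := R^o) f.

Definition direct_energy : R :=
  lattice_sum (fun n => \sum_(i < N) \sum_(j < N)
    if (i == j) && (n == (0, 0)) then 0
    else qval S i * qval S j * (lattice_dist n i j (zpos S j))^-1).

Definition image_energy (l : nat) : R :=
  lattice_sum (fun n => \sum_(i < N) \sum_(j < N)
    qval S i * qval S j *
    (gamma_plus l / lattice_dist n i j (z_plus l j)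
     + gamma_minus l / lattice_dist n i j (z_minus l j))).

(* The sum over the orders l is outside the lattice sum. The order matters:
   when |gamma_top| = |gamma_bot| = 1 the double series over (n, l) need not
   converge absolutely. *)
Definition energy : R :=
  2^-1 * (direct_energy + \big[+%R/0]_(1 <= l <oo) image_energy l).

Definition truncated_energy (M : nat) : R :=
  2^-1 * (direct_energy + \sum_(1 <= l < M.+1) image_energy l).

End Energy.

(* Main.v *)
(* Write 1/r as (2/pi) times the integral over t > 0 of dt/(r^2 + t^2).  Summed
   along one lattice direction of period L, the integrand becomes
   c/(2A) sinh(cA)/(cosh(cA) - cos(cx)) with c = 2pi/L and A^2 = r^2 - x^2 + t^2,
   i.e. c/(2A) up to an error O(e^{-cA}/A).  The main term integrates to a
   two-dimensional logarithmic potential, whose derivative in z is summed along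
   the second lattice direction by the same formula; there the main term cancels
   by neutrality.  Integrating e^{-cA}/A over t and summing over the second
   direction costs no power of z, so image order l contributes
   O(|gamma^(l)| e^{-kappa (l-1) H}) with kappa = 2pi/max(Lx, Ly), and the tail
   over l > M is geometric.  Integrals are avoided throughout: each "integral" is
   an explicit antiderivative (atan, ln), and integrated inequalities are the mean
   value theorem [ler_diff_majorant]. *)
Require Import Defs.
From HB Require Import structures.
From mathcomp Require Import all_boot all_order all_algebra.
From mathcomp Require Import all_classical all_reals all_analysis.
From mathcomp Require Import ring lra zify finmap.
From mathcomp.analysis.showcase Require summability.

Set Implicit Arguments.
Unset Strict Implicit.
Unset Printing Implicit Defensive.

Import Order.TTheory GRing.Theory Num.Theory.
Import numFieldNormedType.Exports.

Local Open Scope classical_set_scope.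
Local Open Scope ring_scope.

(** * Mean value comparison and elementary bounds *)

(** The sum over a single pair of charges diverges, so no limit can be taken termwise: all estimates
    concern finite boxes and carry an arbitrary error [e]. The cutoffs that stand for infinity ([T]
    in the integration variable, [V1] in height) are chosen from [e], then the box size [m] in the
    second direction, then [n] in the first, depending on [m]. Hence the estimates beyond a cutoff
    must be uniform in the number of nodes, and the kernel estimates uniform in the integration
    variable up to the cutoff. Neutrality removes the common growth at each cutoff, so that the
    wanted sum remains at the other end of the integration. Box sides are powers of two because the
    closed form of the kernel is reached through a duplication formula, without Fourier analysis;
    this is harmless, since bounds on boxes that exhaust the lattice suffice. *)

Lemma ler_diff_majorant (R : realType) (f f' B B' : R -> R) (a b : R) :
  a <= b ->
  (forall t, a <= t <= b -> is_derive t 1 f (f' t)) ->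
  (forall t, a <= t <= b -> is_derive t 1 B (B' t)) ->
  (forall t, a <= t <= b -> `|f' t| <= B' t) ->
  `|f b - f a| <= B b - B a.
Proof.
move=> ab df dB fB.
have cont (g g' : R -> R) : (forall t, a <= t <= b -> is_derive t 1 g (g' t)) ->
    {within `[a, b], continuous g}.
  move=> dg; apply: derivable_within_continuous => t; rewrite in_itv /= => tab.
  by have [] := dg t tab.
have aux (g g' : R -> R) : (forall t, a <= t <= b -> is_derive t 1 g (g' t)) ->
    (forall t, a <= t <= b -> 0 <= g' t) -> 0 <= g b - g a.
  move=> dg g'0; have [|c|c] := @MVT_segment R g g' a b ab.
  - move=> x; rewrite in_itv /= => /andP[x1 x2]; apply: dg.
    by rewrite !ltW.
  - exact: (cont g g').
  - by rewrite in_itv /= => cab ->; rewrite mulr_ge0 ?g'0// subr_ge0.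
have h1 : 0 <= (B \+ f) b - (B \+ f) a.
  apply: (aux _ (fun t => B' t + f' t)).
    by move=> t tab; apply: is_deriveD; [exact: dB|exact: df].
  by move=> t /fB; rewrite ler_norml => /andP[]; lra.
have h2 : 0 <= (B \- f) b - (B \- f) a.
  apply: (aux _ (fun t => B' t - f' t)).
    by move=> t tab; apply: is_deriveB; [exact: dB|exact: df].
  by move=> t /fB; rewrite ler_norml => /andP[]; lra.
by move: h1 h2 => /=; rewrite ler_norml => *; apply/andP; split; lra.
Qed.

Lemma ler_of_derive_ge0 (R : realType) (g g' : R -> R) (a b : R) : a <= b ->
  (forall t, a <= t <= b -> is_derive t 1 g (g' t)) ->
  (forall t, a <= t <= b -> 0 <= g' t) -> g a <= g b.
Proof.
move=> ab dg g'0; rewrite -subr_ge0.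
apply: le_trans (@ler_diff_majorant R (cst 0) (cst 0) g g' a b ab _ dg _).
  exact: normr_ge0.
by move=> t /g'0; rewrite normr0.
Qed.

Section elementary_bounds.
Context {R : realType}.
Implicit Types x y a b : R.

Lemma sin_le x : 0 <= x -> sin x <= x.
Proof.
move=> x0; rewrite -subr_ge0.
have := @ler_of_derive_ge0 R (fun t => t - sin t) (fun t => 1 - cos t) 0 x x0 _ _.
rewrite sin0 !subr0; apply => t _.
by rewrite subr_ge0 cos_le1.
Qed.

Lemma cos_half x : cos x = 1 - 2 * sin (x / 2) ^+ 2.
Proof.
rewrite [in LHS](_ : x = (x / 2) *+ 2); last by rewrite -mulr_natr divfK.
by rewrite cos_mulr2n cos2sin2; ring.
Qed.

Lemma sin_sqr_le x : sin x ^+ 2 <= x ^+ 2.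
Proof.
wlog x0 : x / 0 <= x.
  move=> h; have [/h//|/ltW x0] := leP 0 x.
  by rewrite -[sin x ^+ 2]sqrrN -sinN -[x ^+ 2]sqrrN h ?oppr_ge0.
have [x1|x1] := leP x 1.
  rewrite ler_sqr ?nnegrE ?sin_le//.
  by apply: sin_ge0_pi; rewrite x0 (le_trans x1)// (le_trans _ (pi_ge2 R))// ler1n.
have := sin_max x; rewrite ler_norml => /andP[h1 h2]; nra.
Qed.

Lemma cos_ge x : 1 - x ^+ 2 / 2 <= cos x.
Proof. by rewrite cos_half; have := sin_sqr_le (x / 2); lra. Qed.

Lemma sin_ge x : 0 <= x -> x - x ^+ 3 / 6 <= sin x.
Proof.
move=> x0.
have := @ler_of_derive_ge0 R (fun t => sin t - (t - t ^+ 3 / 6))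
  (fun t => cos t - (1 - t ^+ 2 / 2)) 0 x x0 _ _.
rewrite sin0 /= expr0n/= mul0r !subr0 subr_ge0; apply => t _.
  apply: is_derive_eq; rewrite /GRing.scale /=; by field.
by rewrite subr_ge0 cos_ge.
Qed.

(** The first bound serves the denominator in [periodic_kernel_approx]; the second serves the
    numerator, where only an error of order four may remain. The range 2 is half of the 4 there. *)
Lemma sin_sqr_bounds x : `|x| <= 2 ->
  x ^+ 2 / 9 <= sin x ^+ 2 /\ x ^+ 2 - x ^+ 4 / 3 <= sin x ^+ 2.
Proof.
wlog x0 : x / 0 <= x.
  move=> h; have [/h//|/ltW x0] := leP 0 x.
  have e n : x ^+ n.*2 = (- x) ^+ n.*2 by rewrite -mul2n !exprM sqrrN.
  by rewrite -[sin x ^+ 2]sqrrN -sinN (e 1%N) (e 2%N) -normrN; apply: h; lra.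
rewrite ger0_norm// => x2; have := sin_ge x0; set s := sin x => hs.
have h0 : x / 3 <= s.
  have : 0 <= x * (4 - x ^+ 2) by rewrite mulr_ge0// subr_ge0; nra.
  by lra.
have h1 : 0 <= x - x ^+ 3 / 6.
  have : 0 <= x * (6 - x ^+ 2) by rewrite mulr_ge0// subr_ge0; nra.
  by lra.
split; first by nra.
have : (x - x ^+ 3 / 6) ^+ 2 <= s ^+ 2 by rewrite ler_sqr ?nnegrE//; lra.
by move=> h; apply: le_trans h; have : 0 <= x ^+ 6 by [rewrite exprn_ge0]; lra.
Qed.

(** * Hyperbolic sine and cosine *)

Definition sinhR x : R := (expR x - expR (- x)) / 2.
Definition coshR x : R := (expR x + expR (- x)) / 2.

Lemma is_derive_expRN x : is_derive x 1 (fun t : R => expR (- t)) (- expR (- x)).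
Proof.
have h : is_derive x 1 (expR \o -%R) (expR (- x) * - 1) by apply: is_derive1_comp.
by apply: is_derive_eq h _; rewrite mulrN1.
Qed.

Lemma is_derive_sinhR x : is_derive x 1 sinhR (coshR x).
Proof.
rewrite /sinhR /coshR; have h := is_derive_expRN x.
by apply: is_derive_eq; rewrite /GRing.scale /=; field.
Qed.

Lemma coshR_sqr x : coshR x ^+ 2 = 1 + sinhR x ^+ 2.
Proof. by rewrite /coshR /sinhR; have := expRxMexpNx_1 x; nra. Qed.

Lemma sinhR_double x : sinhR (x *+ 2) = 2 * (sinhR x * coshR x).
Proof. by rewrite /coshR /sinhR -mulNrn mulr2n expRD [(- x) *+ 2]mulr2n expRD; field. Qed.

Lemma coshR_double x : coshR (x *+ 2) = 1 + 2 * sinhR x ^+ 2.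
Proof.
rewrite /coshR /sinhR -mulNrn mulr2n expRD [(- x) *+ 2]mulr2n expRD.
have := expRxMexpNx_1 x; nra.
Qed.

Lemma coshR_ge1 x : 1 <= coshR x.
Proof. by rewrite /coshR; have := expR_ge1Dx x; have := expR_ge1Dx (- x); lra. Qed.

Lemma sinhR0 : sinhR 0 = 0.
Proof. by rewrite /sinhR oppr0 subrr mul0r. Qed.

Lemma sinhR_ge x : 0 <= x -> x <= sinhR x.
Proof.
move=> x0.
have := @ler_of_derive_ge0 R (fun t => sinhR t - t) (fun t => coshR t - 1) 0 x x0 _ _.
rewrite sinhR0 subr0 subr_ge0; apply => t _.
  by have h := is_derive_sinhR t; apply: is_derive_eq.
by rewrite subr_ge0 coshR_ge1.
Qed.

Lemma coshR_le32 x : 0 <= x <= 1 / 2 -> coshR x <= 3 / 2.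
Proof.
move=> /andP[x0 x1]; rewrite /coshR.
have e1 : expR (- x) <= 1 by rewrite expR_le1; lra.
have := expR_ge1Dx (- x); have := expRxMexpNx_1 x; have := expR_gt0 x; nra.
Qed.

Lemma sinhR_le2 x : 0 <= x <= 1 / 2 -> sinhR x <= 2 * x.
Proof.
move=> /andP[x0 x1].
have := @ler_of_derive_ge0 R (fun t => 2 * t - sinhR t) (fun t => 2 - coshR t) 0 x x0 _ _.
rewrite sinhR0 mulr0 subr0 subr_ge0; apply => t /andP[t0 t1].
  have h := is_derive_sinhR t; apply: is_derive_eq; rewrite /GRing.scale /=; by ring.
by have := @coshR_le32 t; lra.
Qed.

Lemma coshR_le x : 0 <= x <= 1 / 2 -> coshR x <= 1 + 2 * x ^+ 2.
Proof.
move=> /andP[x0 x1]; rewrite [X in coshR X](_ : x = (x / 2) *+ 2) ?coshR_double; last first.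
  by rewrite -mulr_natr divfK.
have h1 : sinhR (x / 2) <= 2 * (x / 2) by apply: sinhR_le2; lra.
have h2 : x / 2 <= sinhR (x / 2) by apply: sinhR_ge; lra.
by nra.
Qed.

Lemma sinhR_le x : 0 <= x <= 1 / 2 -> sinhR x <= x + x ^+ 3.
Proof.
move=> /andP[x0 x1].
have := @ler_of_derive_ge0 R (fun t => t + t ^+ 3 - sinhR t)
  (fun t => 1 + 3 * t ^+ 2 - coshR t) 0 x x0 _ _.
rewrite sinhR0 expr0n /= addr0 subr0 subr_ge0; apply => t /andP[t0 t1].
  have h := is_derive_sinhR t; apply: is_derive_eq; rewrite /GRing.scale /=; by ring.
by have := @coshR_le t; nra.
Qed.

End elementary_bounds.

(** * The periodic Poisson kernel *)

Section periodic_kernel.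
Context {R : realType}.
Implicit Types x y a b c L : R.

(** Equal to (1 - r^2) / (1 - 2 r cos x + r^2) at r = [expR (- a)], and to the sum over all integers
    k of 2 a / ((x + 2 pi k)^2 + a^2). *)
Definition periodic_kernel x a : R := sinhR a / (coshR a - cos x).

(** The subtracted fraction is the central term of that series; for |x| <= 4 < 2 pi the other terms
    sum to O(a). Since 4 exceeds pi, there is room for the offset of the nodes in
    [periodic_kernel_node_sum]. *)
Lemma periodic_kernel_approx x a : 0 < a <= 1 -> `|x| <= 4 ->
  `|periodic_kernel x a - 2 * a / (x ^+ 2 + a ^+ 2)| <= 24 * a.
Proof.
move=> /andP[a0 a1] x4; pose b := a / 2; pose y := x / 2.
have ae : a = b *+ 2 by rewrite -mulr_natr divfK.
have xe : x = y * 2 by rewrite divfK.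
have b01 : 0 <= b <= 1 / 2 by rewrite /b; lra.
have [b0 b1] : 0 < b /\ b <= 1 / 2 by rewrite /b; lra.
have y2 : `|y| <= 2.
  by rewrite /y normrM [X in _ * X]gtr0_norm ?invr_gt0// ler_pdivrMr//; lra.
have [sy1 sy2] := sin_sqr_bounds y2; have sy3 := sin_sqr_le y.
have h1 := sinhR_ge (ltW b0); have h2 := sinhR_le b01.
have c1 := coshR_ge1 b; have c2 := coshR_le b01.
rewrite /periodic_kernel ae sinhR_double coshR_double cos_half -/y.
clearbody b y; set h := sinhR b in h1 h2 *; set ch := coshR b in c1 c2 *.
set s := sin y in sy1 sy2 sy3 *.
have -> : 2 * (h * ch) / (1 + 2 * h ^+ 2 - (1 - 2 * s ^+ 2))
    = h * ch / (h ^+ 2 + s ^+ 2).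
  have d : h ^+ 2 + s ^+ 2 != 0 by rewrite gt_eqF//; nra.
  rewrite (_ : 1 + _ - _ = 2 * (h ^+ 2 + s ^+ 2)); last by ring.
  by field.
have D0 : 0 < y ^+ 2 + b ^+ 2 by nra.
have -> : 2 * (b *+ 2) / (x ^+ 2 + (b *+ 2) ^+ 2) = b / (y ^+ 2 + b ^+ 2).
  rewrite xe (mulr2n b) [X in _ / X](_ : _ = 4 * (y ^+ 2 + b ^+ 2)); last by ring.
  by field; rewrite gt_eqF.
have D1 : (y ^+ 2 + b ^+ 2) / 9 <= h ^+ 2 + s ^+ 2 by nra.
have D2 : 0 < h ^+ 2 + s ^+ 2 by lra.
have -> : h * ch / (h ^+ 2 + s ^+ 2) - b / (y ^+ 2 + b ^+ 2) =
   (h * ch * (y ^+ 2 + b ^+ 2) - b * (h ^+ 2 + s ^+ 2))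
    / ((h ^+ 2 + s ^+ 2) * (y ^+ 2 + b ^+ 2)).
  by field; rewrite !gt_eqF.
rewrite normrM normfV [X in _ / X]gtr0_norm ?mulr_gt0// ler_pdivrMr ?mulr_gt0//.
rewrite (mulr2n b).
have hch1 : b <= h * ch by nra.
have hch2 : h * ch <= b * (1 + 4 * b ^+ 2).
  have : h * ch <= (b + b ^+ 3) * (1 + 2 * b ^+ 2) by apply: ler_pM => //; lra.
  have : 0 <= b ^+ 3 * (1 / 4 - b ^+ 2) by rewrite mulr_ge0 ?exprn_ge0//; nra.
  have : 0 <= b ^+ 3 by rewrite exprn_ge0 ?ltW.
  lra.
have hh : h ^+ 2 <= b ^+ 2 + 3 * b ^+ 4.
  have : h ^+ 2 <= (b + b ^+ 3) ^+ 2 by rewrite ler_sqr ?nnegrE//; nra.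
  have : 0 <= b ^+ 4 * (1 / 4 - b ^+ 2) by rewrite mulr_ge0 ?exprn_ge0//; nra.
  have : 0 <= b ^+ 4 by rewrite exprn_ge0 ?ltW.
  lra.
set D := y ^+ 2 + b ^+ 2 in D0 D1 *.
have b2D : b ^+ 2 <= D by rewrite lerDr sqr_ge0.
have y2D : y ^+ 2 <= D by rewrite lerDl sqr_ge0.
have b4 : b ^+ 4 <= D ^+ 2.
  by rewrite (_ : 4 = 2 * 2)%N// exprM ler_sqr ?nnegrE ?sqr_ge0// ltW.
have y4 : y ^+ 4 <= D ^+ 2.
  by rewrite (_ : 4 = 2 * 2)%N// exprM ler_sqr ?nnegrE ?sqr_ge0// ltW.
have b2y : b ^+ 2 * D <= D ^+ 2 by rewrite [D ^+ 2]expr2 ler_pM2r.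
(* A numerator of at most [5 * b * D ^+ 2] over a denominator of at least [D ^+ 2 / 9] gives
   [45 * b], that is 22.5 a, within the claimed 24 a. *)
have N1 : h * ch * D - b * (h ^+ 2 + s ^+ 2) <= 5 * b * D ^+ 2.
  have : h * ch * D <= b * (1 + 4 * b ^+ 2) * D by rewrite ler_pM2r.
  have : b * (b ^+ 2 + y ^+ 2 - y ^+ 4 / 3) <= b * (h ^+ 2 + s ^+ 2).
    by rewrite ler_pM2l//; nra.
  have : 0 <= b * (D ^+ 2 - b ^+ 2 * D) by rewrite (mulr_ge0 (ltW b0))// subr_ge0.
  have : 0 <= b * (D ^+ 2 - y ^+ 4) by rewrite (mulr_ge0 (ltW b0))// subr_ge0.
  have : D = y ^+ 2 + b ^+ 2 by [].
  have : 0 <= b * D ^+ 2 by rewrite (mulr_ge0 (ltW b0))// exprn_ge0 ?ltW.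
  nra.
have N2 : - (5 * b * D ^+ 2) <= h * ch * D - b * (h ^+ 2 + s ^+ 2).
  have : b * D <= h * ch * D by rewrite ler_pM2r.
  have : b * (h ^+ 2 + s ^+ 2) <= b * (b ^+ 2 + 3 * b ^+ 4 + y ^+ 2).
    by rewrite ler_pM2l//; lra.
  have : 0 <= b * (D ^+ 2 - b ^+ 4) by rewrite (mulr_ge0 (ltW b0))// subr_ge0.
  have : D = y ^+ 2 + b ^+ 2 by [].
  have : 0 <= b * D ^+ 2 by rewrite (mulr_ge0 (ltW b0))// exprn_ge0 ?ltW.
  nra.
have : `|h * ch * D - b * (h ^+ 2 + s ^+ 2)| <= 5 * b * D ^+ 2.
  by rewrite ler_norml N2 N1.
move=> /le_trans; apply.
have : 0 <= b * (D * ((h ^+ 2 + s ^+ 2) - D / 9)).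
  by rewrite (mulr_ge0 (ltW b0))// (mulr_ge0 (ltW D0))// subr_ge0.
have : 0 <= b * D ^+ 2 by rewrite (mulr_ge0 (ltW b0))// exprn_ge0 ?ltW.
lra.
Qed.

End periodic_kernel.

(** * Kernel sums over dyadic windows of nodes *)

Section node_sums.
Context {R : realType}.
Implicit Types x y a b c d L : R.

Lemma coshR_gt_cos x a : 0 < a -> 0 < coshR a - cos x.
Proof.
move=> a0; rewrite subr_gt0; apply: le_lt_trans (cos_le1 x) _.
have -> : a = (a / 2) *+ 2 by rewrite -mulr_natr divfK.
rewrite coshR_double ltrDl mulr_gt0// exprn_gt0//.
by apply: lt_le_trans (sinhR_ge _); lra.
Qed.

(* The duplication formula.  Iterated, it spreads the kernel over [2 ^ m] nodes, where
   [periodic_kernel_approx] applies to every term (Herglotz's trick). *)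
Lemma periodic_kernel_split x a : 0 < a ->
  periodic_kernel x a =
  (periodic_kernel (x / 2) (a / 2) + periodic_kernel (x / 2 + pi) (a / 2)) / 2.
Proof.
move=> a0; rewrite /periodic_kernel.
have b0 : 0 < a / 2 by rewrite divr_gt0.
have := coshR_gt_cos x a0; have := coshR_gt_cos (x / 2) b0.
have := coshR_gt_cos (x / 2 + pi) b0; rewrite cosDpi opprK => p1 p2.
rewrite -[in coshR a](divfK (_ : 2 != 0) a)// -[in sinhR a](divfK (_ : 2 != 0) a)//.
rewrite mulr_natr sinhR_double coshR_double cos_half.
have := cos2sin2 (x / 2); have := coshR_sqr (a / 2).
move: (sinhR (a / 2)) (coshR (a / 2)) (cos (x / 2)) (sin (x / 2)) p1 p2.
move=> h ch co s p1 p2 e1 e2 p3.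
have -> : 1 + 2 * h ^+ 2 - (1 - 2 * s ^+ 2) = 2 * ((ch - co) * (ch + co)) by nra.
by field; rewrite !gt_eqF.
Qed.

Lemma periodic_kernel_sum m x a : 0 < a ->
  periodic_kernel x a = (2 ^+ m)^-1 *
  \sum_(k < 2 ^ m) periodic_kernel ((x + 2 * pi * k%:R) / 2 ^+ m) (a / 2 ^+ m).
Proof.
move=> a0; elim: m => [|m IH].
  by rewrite expr0 invr1 mul1r big_ord1 mulr0 addr0 !mulr1.
have n0 : 2 ^+ m != 0 :> R by rewrite expf_neq0.
(* The indices [k] and [2 ^ m + k] supply the two terms of the duplication: the extra 2 pi 2^m,
   divided by 2^(m+1), is pi. *)
rewrite IH expnS mul2n -addnn big_split_ord /= -big_split /= exprS invfM.
rewrite -mulrA mulrCA; congr (_ * _); rewrite mulr_sumr; apply: eq_bigr => k _.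
rewrite periodic_kernel_split ?divr_gt0 ?exprn_gt0// mulrC; congr (_ * (_ + _)).
  by congr periodic_kernel; field.
by congr periodic_kernel; [rewrite natrD natrX|]; field.
Qed.

(** For [k < 2 ^ m.+1] these are the multiples of [L] by the integers from -2^m to 2^m - 1; the
    windows are nested in [m] and exhaust all multiples. *)
Definition node L m (k : nat) : R := L * (k%:R - 2 ^+ m).

Lemma exp2_ge r : exists m0 : nat, forall m, (m0 <= m)%N -> r <= 2 ^+ m :> R.
Proof.
exists (Num.truncn `|r|).+1 => m mm.
apply: le_trans (ler_norm r) _; apply: le_trans (ltW (truncnS_gt _)) _.
by rewrite -natrX ler_nat; apply: leq_trans mm (ltnW (ltn_expl _ _)).
Qed.

Lemma periodic_kernel_node_sum m x a : 0 < a <= 2 ^+ m.+1 ->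
  `|x| / 2 ^+ m.+1 + pi <= 4 ->
  `|\sum_(k < 2 ^ m.+1) 2 * a / ((x + node (2 * pi) m k) ^+ 2 + a ^+ 2)
     - periodic_kernel x a| <= 24 * a / 2 ^+ m.+1.
Proof.
move=> /andP[a0 aN] xN.
(* Shifting by 2^m periods centers the window: the rescaled nodes then lie in [-pi, pi], up to |x| /
   2^(m+1). *)
have -> : periodic_kernel x a = periodic_kernel (x - 2 * pi * 2 ^+ m) a.
  rewrite /periodic_kernel; congr (_ / (_ - _)).
  rewrite -[in LHS](subrK (2 * pi * 2 ^+ m) x) -natrX mulr_natr mulrC mulr_natr.
  exact: (periodicn (@cosD2pi R)).
rewrite (periodic_kernel_sum m.+1) //.
set N := 2 ^+ m.+1 in aN xN *.
have N0 : 0 < N by rewrite exprn_gt0.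
have -> : 24 * a / N = \sum_(k < 2 ^ m.+1) N^-1 * (24 * (a / N)).
  rewrite sumr_const card_ord -[RHS]mulr_natl natrX -/N.
  by field; rewrite gt_eqF.
rewrite mulr_sumr -sumrB; apply: le_trans (ler_norm_sum _ _ _) _.
apply: ler_sum => k _.
have -> : x - 2 * pi * 2 ^+ m + 2 * pi * k%:R = x + node (2 * pi) m k.
  by rewrite /node; ring.
set y := x + node _ _ _.
have y4 : `|y / N| <= 4.
  rewrite normrM normfV (gtr0_norm N0); apply: le_trans xN.
  rewrite ler_pdivrMr// mulrDl divfK ?gt_eqF//; apply: le_trans (ler_normD _ _) _.
  have -> : pi * N = 2 * pi * 2 ^+ m by rewrite /N exprS; ring.
  have pi2 : 0 < 2 * pi :> R by rewrite mulr_gt0 ?pi_gt0.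
  rewrite lerD2l /node normrM gtr0_norm// ler_pM2l//.
  have kN : (k%:R : R) <= 2 * 2 ^+ m by rewrite -exprS -natrX ler_nat ltnW.
  have k0 : 0 <= k%:R :> R by [].
  by rewrite ler_norml; apply/andP; split; lra.
have aN1 : 0 < a / N <= 1 by rewrite divr_gt0//= ler_pdivrMr// mul1r.
have := periodic_kernel_approx aN1 y4; rewrite distrC.
have -> : 2 * (a / N) / ((y / N) ^+ 2 + (a / N) ^+ 2)
   = N * (2 * a / (y ^+ 2 + a ^+ 2)).
  by field; rewrite !gt_eqF//=; nra.
move=> h; rewrite -[X in `|X - _|](mulKf (_ : N != 0)) ?gt_eqF// -mulrBr.
by rewrite normrM normfV (gtr0_norm N0) ler_pM2l ?invr_gt0.
Qed.

(** With E = [expR (- a)], the product 2 (cosh a - cos x) E is the squared modulus of 1 - E e^(ix),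
    hence at least (1 - e^(-d))^2; the numerator cos x - E of the difference is at most 2 in
    modulus. *)
Lemma periodic_kernel_sub1 d : 0 < d -> exists2 C : R, 0 < C &
  forall x a, d <= a -> `|periodic_kernel x a - 1| <= C * expR (- a).
Proof.
move=> d0; have e1 : expR (- d) < 1 by rewrite expR_lt1 oppr_lt0.
have q0 : 0 < (1 - expR (- d)) ^+ 2 by rewrite exprn_gt0// subr_gt0.
exists (4 / (1 - expR (- d)) ^+ 2); first by rewrite divr_gt0.
move=> x a da; have a0 : 0 < a by apply: lt_le_trans da.
have D0 := coshR_gt_cos x a0.
have -> : periodic_kernel x a - 1 = (cos x - expR (- a)) / (coshR a - cos x).
  rewrite /periodic_kernel -[X in _ - X](@divff _ (coshR a - cos x)) ?gt_eqF//.
  by rewrite -mulrBl; congr (_ / _); rewrite /sinhR /coshR; field.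
rewrite normrM normfV (gtr0_norm D0) ler_pdivrMr//.
have ea : expR (- a) <= expR (- d) by rewrite ler_expR lerN2.
have c1 := cos_le1 x; have c2 := cos_geN1 x; have p1 := expR_gt0 (- a).
have : `|cos x - expR (- a)| <= 2 by rewrite ler_norml; apply/andP; split; lra.
move=> /le_trans; apply.
set E := expR (- a) in ea p1 *.
have eE : expR a * E = 1 by rewrite /E expRxMexpNx_1.
have h : (1 - expR (- d)) ^+ 2 <= 2 * ((coshR a - cos x) * E).
  have -> : 2 * ((coshR a - cos x) * E) = 1 + E ^+ 2 - 2 * cos x * E.
    by rewrite -[X in X + _ - _]eE /coshR -/E; field.
  nra.
rewrite (_ : _ * _ * _ = 2 * (2 * ((coshR a - cos x) * E)) / (1 - expR (- d)) ^+ 2).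
  by rewrite ler_pdivlMr//; lra.
by field; rewrite subr_eq0 eq_sym; move: e1; rewrite lt_neqAle => /andP[].
Qed.

Lemma node_sum_le_succ L m x a :
  \sum_(k < 2 ^ m.+1) ((x + node L m k) ^+ 2 + a ^+ 2)^-1 <=
  \sum_(k < 2 ^ m.+2) ((x + node L m.+1 k) ^+ 2 + a ^+ 2)^-1.
Proof.
have e : (2 ^ m.+2 = 2 ^ m + (2 ^ m.+1 + 2 ^ m))%N.
  by rewrite !expnS; lia.
have p y : 0 <= (y ^+ 2 + a ^+ 2)^-1 by rewrite invr_ge0 addr_ge0 ?sqr_ge0.
rewrite e big_split_ord big_split_ord /=.
rewrite -[leLHS]add0r lerD ?sumr_ge0// -[leLHS]addr0 lerD ?sumr_ge0//.
rewrite le_eqVlt; apply/orP; left; apply/eqP; apply: eq_bigr => k _.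
have -> // : node L m.+1 (2 ^ m + k) = node L m k.
by rewrite /node natrD natrX exprS; ring.
Qed.

Lemma node_sum_le_mono L m m' x a : (m <= m')%N ->
  \sum_(k < 2 ^ m.+1) ((x + node L m k) ^+ 2 + a ^+ 2)^-1 <=
  \sum_(k < 2 ^ m'.+1) ((x + node L m' k) ^+ 2 + a ^+ 2)^-1.
Proof.
move=> /subnK <-; elim: (m' - m)%N => [//|n IH]; rewrite addSn.
exact: le_trans IH (node_sum_le_succ _ _ _ _).
Qed.

Section scaled.
Variables L c : R.
Hypotheses (c0 : 0 < c) (cL : c * L = 2 * pi).

(** The error of [periodic_kernel_node_sum] is proportional to [a], and so is the factor divided out
    by the scaling: the result is uniform in [a]. The threshold depends on [x] only, which permits
    integration in a variable inside [a] at fixed [m]. *)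
Lemma node_sum_kernel : exists2 C, 0 < C & forall x, exists m0, forall m,
  (m0 <= m)%N -> forall a, 0 < a -> c * a <= 2 ^+ m ->
  `|\sum_(k < 2 ^ m.+1) ((x + node L m k) ^+ 2 + a ^+ 2)^-1
    - c / 2 / a * periodic_kernel (c * x) (c * a)| <= C / 2 ^+ m.
Proof.
have pi4 : 0 < 4 - pi :> R by rewrite subr_gt0 (lt_le_trans (_ : _ < 2 *+ 2))//;
  have := pihalf_lt2 R; lra.
exists (c ^+ 2 * 24) => [|x]; first by rewrite mulr_gt0// exprn_gt0.
have [m0 hm0] := exp2_ge (`|c * x| / (4 - pi)); exists m0 => m mm a a0 aN.
have N0 : 0 < 2 ^+ m :> R by rewrite exprn_gt0.
have ca0 : 0 < c * a by rewrite mulr_gt0.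
have xN : `|c * x| / 2 ^+ m.+1 + pi <= 4.
  rewrite -lerBrDr ler_pdivrMr ?exprn_gt0//.
  have := hm0 _ mm; rewrite ler_pdivrMr// => /le_trans; apply.
  rewrite [leLHS]mulrC.
  by rewrite ler_pM2l// exprS ler_pMl// ler1n.
have aN' : 0 < c * a <= 2 ^+ m.+1 by rewrite ca0 exprS; lra.
have := periodic_kernel_node_sum aN' xN.
have -> : \sum_(k < 2 ^ m.+1) 2 * (c * a) / ((c * x + node (2 * pi) m k) ^+ 2 + (c * a) ^+ 2)
   = (2 * a / c) * \sum_(k < 2 ^ m.+1) ((x + node L m k) ^+ 2 + a ^+ 2)^-1.
  rewrite mulr_sumr; apply: eq_bigr => k _.
  have -> : c * x + node (2 * pi) m k = c * (x + node L m k).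
    by rewrite /node -cL; ring.
  have q0 : (x + node L m k) ^+ 2 + a ^+ 2 != 0.
    by rewrite gt_eqF// ltr_wpDl ?sqr_ge0 ?exprn_gt0.
  rewrite (exprMn 2 c (_ + _)) (exprMn 2 c a) -[_ + c ^+ 2 * _]mulrDr; move: (_ + a ^+ 2) q0 => q q0.
  by field; rewrite q0 gt_eqF.
set S := \sum_(_ < _) _; set K := periodic_kernel _ _ => h.
have -> : S - c / 2 / a * K = (c / 2 / a) * (2 * a / c * S - K).
  by field; rewrite !gt_eqF.
have ca : 0 < c / 2 / a by rewrite !divr_gt0.
rewrite normrM (gtr0_norm ca).
apply: le_trans (ler_wpM2l (ltW ca) h) _.
rewrite exprS.
have -> : c / 2 / a * (24 * (c * a) / (2 * 2 ^+ m)) = c ^+ 2 * 24 / 2 ^+ m / 4.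
  by field; rewrite !gt_eqF.
by rewrite ler_pdivrMr// ler_pMr ?ler1n// divr_gt0// mulr_gt0// exprn_gt0.
Qed.

(** As the terms are nonnegative, a window may be enlarged until the kernel estimate applies; this
    removes any relation between [m], [x] and [a]. *)
Lemma node_sum_le d : 0 < d -> exists2 C, 0 < C & forall x m a, d <= a ->
  \sum_(k < 2 ^ m.+1) ((x + node L m k) ^+ 2 + a ^+ 2)^-1 <= C / a.
Proof.
move=> d0.
have [C1 C10 hC1] := node_sum_kernel.
have [C2 C20 hC2] := periodic_kernel_sub1 (mulr_gt0 c0 d0).
exists (c / 2 * (1 + C2) + C1) => [|x m a da].
  by rewrite addr_gt0// mulr_gt0 ?divr_gt0// addr_gt0.
have a0 : 0 < a by apply: lt_le_trans da.
have [m0 hm0] := hC1 x; have [m1 hm1] := exp2_ge (c * a).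
have [m2 hm2] := exp2_ge a.
pose m' := maxn m (maxn m0 (maxn m1 m2)).
have mm : (m <= m')%N by rewrite leq_maxl.
apply: le_trans (node_sum_le_mono L x a mm) _.
have mm0 : (m0 <= m')%N by rewrite /m' !leq_max leqnn !orbT.
have mm1 : (m1 <= m')%N by rewrite /m' !leq_max leqnn !orbT.
have := hm0 m' mm0 a a0 (hm1 m' mm1); rewrite ler_norml => /andP[_].
have := hC2 (c * x) (c * a) _; rewrite ler_pM2l// => /(_ da).
rewrite ler_norml => /andP[_].
set K := periodic_kernel _ _; set S := \sum_(_ < _) _ => hK hS.
have e1 : expR (- (c * a)) <= 1 by rewrite expR_le1 oppr_le0 ltW// mulr_gt0.
have K1 : K <= 1 + C2.
  by have : 0 <= C2 * (1 - expR (- (c * a))) by [rewrite mulr_ge0 ?subr_ge0// ltW]; lra.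
(* The enlarged window also turns the absolute error [C1 / 2 ^+ m'] into a multiple of 1 / a. *)
have a2 : a <= 2 ^+ m' by apply: hm2; rewrite /m' !leq_max leqnn !orbT.
have h1 : C1 / 2 ^+ m' <= C1 / a by rewrite ler_pM2l// lef_pV2 ?posrE// exprn_gt0.
have h2 : c / 2 / a * K <= c / 2 * (1 + C2) / a.
  by rewrite mulrAC ler_pM2r ?invr_gt0// ler_pM2l// divr_gt0.
rewrite mulrDl; lra.
Qed.

End scaled.
End node_sums.

(** * Comparison estimates and antiderivatives *)

Section comparison_bounds.
Context {R : realType}.
Implicit Types x y a b c d t u v w : R.

Lemma recip_shift_le x a : exists2 C, 0 <= C & forall u t, 1 <= t ->
  `|((x + u) ^+ 2 + (a ^+ 2 + t ^+ 2))^-1 - (u ^+ 2 + t ^+ 2)^-1|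
  <= C / t * (u ^+ 2 + t ^+ 2)^-1.
Proof.
pose C1 := x ^+ 2 + `|x| + a ^+ 2; pose C2 := 2 + 2 * x ^+ 2.
have C10 : 0 <= C1 by rewrite !addr_ge0 ?sqr_ge0.
have C20 : 0 <= C2 by rewrite addr_ge0// mulr_ge0// sqr_ge0.
exists (C1 * C2) => [|u t t1]; first exact: mulr_ge0.
have t0 : 0 < t by lra.
set B := (x + u) ^+ 2 + _; set B0 := u ^+ 2 + _.
have B0p : 0 < B0 by rewrite ltr_wpDl ?sqr_ge0// exprn_gt0.
have Bp : 0 < B by rewrite ltr_wpDl ?sqr_ge0// ltr_wpDl ?sqr_ge0// exprn_gt0.
have hB : B0 <= C2 * B.
  have : 0 <= x ^+ 2 * (t ^+ 2 - 1) by rewrite mulr_ge0 ?sqr_ge0//; nra.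
  have : 0 <= x ^+ 2 * (x + u) ^+ 2 by rewrite mulr_ge0 ?sqr_ge0.
  have : 0 <= x ^+ 2 * a ^+ 2 by rewrite mulr_ge0 ?sqr_ge0.
  have := sqr_ge0 (2 * x + u); have := sqr_ge0 a.
  by rewrite /C2 /B /B0; nra.
have tB : t <= B0 by rewrite /B0; have := sqr_ge0 u; nra.
have uB : 2 * `|u| * t <= B0.
  by rewrite /B0 -[u ^+ 2]real_normK ?num_real//; have := sqr_ge0 (`|u| - t); lra.
have hN : `|B0 - B| * t <= C1 * B0.
  have -> : B0 - B = - (x ^+ 2 + 2 * x * u + a ^+ 2) by rewrite /B0 /B; ring.
  rewrite normrN; apply: (@le_trans _ _ ((x ^+ 2 + `|x| * (2 * `|u|) + a ^+ 2) * t)).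
    rewrite ler_pM2r//; apply: le_trans (ler_normD _ _) _.
    rewrite [X in _ + X]ger0_norm ?sqr_ge0// lerD2r; apply: le_trans (ler_normD _ _) _.
    rewrite ger0_norm ?sqr_ge0// lerD2l !normrM ger0_norm//; lra.
  rewrite /C1 !mulrDl; apply: lerD; last by rewrite ler_wpM2l ?sqr_ge0.
  apply: lerD; first by rewrite ler_wpM2l ?sqr_ge0.
  by rewrite -mulrA ler_wpM2l// !mul1r; lra.
have -> : B^-1 - B0^-1 = (B0 - B) / (B * B0) by field; rewrite !gt_eqF.
rewrite normrM normfV (gtr0_norm (mulr_gt0 Bp B0p)) ler_pdivrMr ?mulr_gt0//.
rewrite (_ : _ * _ * _ = C1 * (C2 * B) / t); last by field; rewrite !gt_eqF.
by rewrite ler_pdivlMr//; apply: le_trans hN _; rewrite ler_wpM2l.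
Qed.

(* The bound factorizes in [u] and [t]; since
   [sqrt w * \int_0^oo dt / (w + t ^+ 2)] and [sqrt w * \sum_u (w + u ^+ 2)^-1]
   are both bounded, no power of [w] is lost in front of [expR (- (c * w))]. *)
Lemma exp_sqrt_div_le c d : 0 < c -> 0 < d -> exists2 C, 0 < C &
  forall w u t A, d <= w -> 0 <= A -> A ^+ 2 = u ^+ 2 + w ^+ 2 + t ^+ 2 ->
  expR (- (c * A)) / A <=
    C * expR (- (c * w)) * (w / (w + u ^+ 2)) * (w + t ^+ 2)^-1.
Proof.
move=> c0 d0.
pose k1 := Num.min 1 (c / 6); pose k2 := Num.min 1 (c * d / 6).
have k10 : 0 < k1 by rewrite lt_min ltr01/= divr_gt0.
have k20 : 0 < k2 by rewrite lt_min ltr01/= divr_gt0// mulr_gt0.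
exists ((k1 ^+ 2)^-1 / k2) => [|w u t A dw A0 A2'].
  by rewrite divr_gt0 ?invr_gt0 ?exprn_gt0.
have w0 : 0 < w by lra.
set r2 := u ^+ 2 + t ^+ 2.
have r20 : 0 <= r2 by rewrite addr_ge0 ?sqr_ge0.
have A2 : A ^+ 2 = w ^+ 2 + r2 by rewrite A2' /r2; ring.
have wA : w <= A by rewrite -ler_sqr ?nnegrE ?(ltW w0)// A2 lerDl.
have Ap : 0 < A by lra.
(* A minorant of [A * q] free of square roots: r2 = (A - w) (A + w) is at most 2 A (A - w). *)
pose g := w + c * r2 / 6.
have g0 : 0 < g by rewrite ltr_pwDl// divr_ge0// mulr_ge0// ltW.
have gA : g <= A * (1 + c * (A - w) / 3).
  have : r2 <= 2 * (A * (A - w)) by nra.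
  move=> h; have : c * r2 <= c * (2 * (A * (A - w))) by rewrite ler_pM2l.
  rewrite /g; lra.
pose q := 1 + c * (A - w) / 3.
have q1 : 1 <= q by rewrite lerDl divr_ge0// mulr_ge0 ?subr_ge0// ltW.
(* Why a cube: up to constants, two factors [g] dominate [w + u ^+ 2] and [w + t ^+ 2], and the
   third, times [w], dominates [A ^+ 2]. *)
have eq3 : q ^+ 3 <= expR (c * (A - w)).
  rewrite (_ : c * (A - w) = 3%:R * (c * (A - w) / 3)); last by field.
  by rewrite expRM_natl lerXn2r ?nnegrE ?expR_ge0 ?expR_ge1Dx//; lra.
have hk1 : k1 * (w + r2) <= g.
  have k1a : k1 <= 1 by rewrite ge_min lexx.
  have k1b : k1 <= c / 6 by rewrite ge_min lexx orbT.
  have : k1 * w <= 1 * w by rewrite ler_pM2r.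
  have : k1 * r2 <= c / 6 * r2 by rewrite ler_wpM2r.
  by rewrite /g; lra.
have hk2 : k2 * A ^+ 2 <= g * w.
  have k2a : k2 <= 1 by rewrite ge_min lexx.
  have k2b : k2 <= c * d / 6 by rewrite ge_min lexx orbT.
  have : k2 * w ^+ 2 <= 1 * w ^+ 2 by rewrite ler_pM2r// exprn_gt0.
  have : k2 * r2 <= c * d / 6 * r2 by rewrite ler_wpM2r.
  have : c * r2 * d <= c * r2 * w by rewrite ler_wpM2l// mulr_ge0// ltW.
  by rewrite A2 /g; lra.
have uw0 : 0 < w + u ^+ 2 by rewrite ltr_pwDl// sqr_ge0.
have tw0 : 0 < w + t ^+ 2 by rewrite ltr_pwDl// sqr_ge0.
have prod_le : (w + u ^+ 2) * (w + t ^+ 2) <= (w + r2) ^+ 2.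
  by rewrite [leRHS]expr2 ler_pM ?(ltW uw0) ?(ltW tw0)// lerD2l /r2 ?lerDl ?lerDr sqr_ge0.
have step : k1 ^+ 2 * k2 * ((w + u ^+ 2) * (w + t ^+ 2)) <= w * (A * q ^+ 3).
  rewrite -(ler_pM2r (exprn_gt0 2 Ap)).
  have e1 : k1 ^+ 2 * ((w + u ^+ 2) * (w + t ^+ 2)) <= g ^+ 2.
    apply: (@le_trans _ _ ((k1 * (w + r2)) ^+ 2)).
      by rewrite exprMn ler_pM2l ?exprn_gt0.
    have kr0 : 0 <= k1 * (w + r2) by apply: mulr_ge0; [exact: ltW|lra].
    by rewrite ler_sqr ?nnegrE ?(ltW g0).
  have e2 : g ^+ 3 <= (A * q) ^+ 3 by rewrite lerXn2r ?nnegrE ?mulr_ge0 ?(ltW g0)//; lra.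
  apply: (@le_trans _ _ (g ^+ 2 * (g * w))).
    rewrite (_ : _ * A ^+ 2 = (k1 ^+ 2 * ((w + u ^+ 2) * (w + t ^+ 2))) * (k2 * A ^+ 2)); last by ring.
    apply: ler_pM => //; first by rewrite mulr_ge0 ?sqr_ge0// mulr_ge0 ?ltW.
    by rewrite mulr_ge0 ?sqr_ge0// ltW.
  rewrite (_ : g ^+ 2 * (g * w) = w * g ^+ 3); last by ring.
  rewrite (_ : w * (A * q ^+ 3) * A ^+ 2 = w * (A * q) ^+ 3); last by ring.
  by rewrite ler_pM2l.
have E0 : 0 < expR (c * (A - w)) by rewrite expR_gt0.
have -> : expR (- (c * A)) / A = expR (- (c * w)) * (A * expR (c * (A - w)))^-1.
  rewrite (_ : - (c * A) = - (c * w) - c * (A - w)); last by ring.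
  by rewrite expRB invfM mulrAC mulrA.
have -> : (k1 ^+ 2)^-1 / k2 * expR (- (c * w)) * (w / (w + u ^+ 2)) / (w + t ^+ 2)
   = expR (- (c * w)) * (w / (k1 ^+ 2 * k2 * ((w + u ^+ 2) * (w + t ^+ 2)))).
  by move: (expR _) => e; field; rewrite !gt_eqF.
rewrite ler_pM2l ?expR_gt0// ler_pdivlMr ?mulr_gt0 ?exprn_gt0//.
rewrite mulrC ler_pdivrMr ?mulr_gt0//; apply: le_trans step _.
by rewrite ler_pM2l// ler_pM2l.
Qed.

Lemma is_derive_atan_div b t : 0 < b ->
  is_derive t 1 (fun s : R => atan (s / b) / b) (b ^+ 2 + t ^+ 2)^-1.
Proof.
move=> b0.
have h1 : is_derive t 1 (fun s : R => s / b) b^-1.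
  by apply: is_derive_eq; rewrite /GRing.scale /=; ring.
have h2 : is_derive t 1 (atan \o (fun s : R => s / b)) ((1 + (t / b) ^+ 2)^-1 * b^-1).
  exact: is_derive1_comp.
have h3 : is_derive t 1 (fun s : R => b^-1 *: (atan \o (fun s : R => s / b)) s)
    (b^-1 *: ((1 + (t / b) ^+ 2)^-1 * b^-1)) by apply: is_deriveZ.
apply: is_derive_eq (_ : is_derive t 1 _ (b^-1 *: ((1 + (t / b) ^+ 2)^-1 * b^-1))) _.
  rewrite (_ : (fun s => _) = (fun s : R => b^-1 *: (atan \o (fun s : R => s / b)) s))//.
  by apply/funext => s /=; rewrite /GRing.scale /= mulrC.
have bt : b ^+ 2 + t ^+ 2 != 0 by rewrite gt_eqF// ltr_pwDl ?exprn_gt0 ?sqr_ge0.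
rewrite /GRing.scale /= (_ : 1 + (t / b) ^+ 2 = (b ^+ 2 + t ^+ 2) / b ^+ 2); last first.
  by field; rewrite gt_eqF.
by move: (b ^+ 2 + _) bt => q q0; field; rewrite q0 gt_eqF.
Qed.

(** This antiderivative is asinh (s / a) + ln a. With this constant it behaves like ln (2 s) at
    infinity whatever [a] is, and its value ln a at 0 is the logarithmic potential. *)
Lemma is_derive_asinh a t : 0 < a ->
  is_derive t 1 (fun s : R => ln (s + Num.sqrt (s ^+ 2 + a ^+ 2)))
    (Num.sqrt (t ^+ 2 + a ^+ 2))^-1.
Proof.
move=> a0; set A := Num.sqrt _.
have q0 : 0 < t ^+ 2 + a ^+ 2 by rewrite ltr_wpDl ?sqr_ge0 ?exprn_gt0.
have A0 : 0 < A by rewrite sqrtr_gt0.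
have tA : `|t| < A.
  by rewrite -sqrtr_sqr ltr_sqrt// ltrDl exprn_gt0.
have tA0 : 0 < t + A by move: tA; rewrite ltr_norml => /andP[]; lra.
have h1 : is_derive t 1 (fun s : R => s ^+ 2 + a ^+ 2) (2 * t).
  by apply: is_derive_eq; rewrite /GRing.scale /=; ring.
have h2 : is_derive t 1 (Num.sqrt \o (fun s : R => s ^+ 2 + a ^+ 2)) ((2 * A)^-1 * (2 * t)).
  by apply: is_derive1_comp; exact: is_derive1_sqrt.
have h3 : is_derive t 1 (id + (Num.sqrt \o (fun s : R => s ^+ 2 + a ^+ 2))) (1 + (2 * A)^-1 * (2 * t)).
  exact: is_deriveD.
have h4 : is_derive t 1 (@ln R \o (id + (Num.sqrt \o (fun s : R => s ^+ 2 + a ^+ 2))))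
   ((t + A)^-1 * (1 + (2 * A)^-1 * (2 * t))).
  by apply: is_derive1_comp; exact: is_derive1_ln.
apply: is_derive_eq h4 _.
by field; rewrite !gt_eqF.
Qed.

Lemma is_derive_ln_sqr y d t : 0 < t + d ->
  is_derive t 1 (fun s : R => ln (y ^+ 2 + (s + d) ^+ 2))
    (2 * (t + d) * (y ^+ 2 + (t + d) ^+ 2)^-1).
Proof.
move=> a0.
have h1 : is_derive t 1 (fun s : R => y ^+ 2 + (s + d) ^+ 2) (2 * (t + d)).
  by apply: is_derive_eq; rewrite /GRing.scale /=; ring.
have q0 : 0 < y ^+ 2 + (t + d) ^+ 2 by rewrite ltr_wpDl ?sqr_ge0 ?exprn_gt0.
have h2 : is_derive t 1 (@ln R \o (fun s : R => y ^+ 2 + (s + d) ^+ 2))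
   ((y ^+ 2 + (t + d) ^+ 2)^-1 * (2 * (t + d))).
  by apply: is_derive1_comp; exact: is_derive1_ln.
by apply: is_derive_eq h2 _; rewrite mulrC.
Qed.

Lemma is_derive_expRM c t :
  is_derive t 1 (fun s : R => expR (c * s)) (c * expR (c * t)).
Proof.
have h1 : is_derive t 1 (fun s : R => c * s) c.
  by apply: is_derive_eq; rewrite /GRing.scale /=; ring.
have h2 : is_derive t 1 (@expR R \o (fun s : R => c * s)) (expR (c * t) * c).
  exact: is_derive1_comp.
by apply: is_derive_eq h2 _; rewrite mulrC.
Qed.

(* Second order is needed: the first-order terms are not summable over [v], and
   they cancel only because the dipole moments vanish as well. *)
Lemma ln_shift_le y d : exists C W0, [/\ 0 <= C, 1 <= W0 & forall v W, W0 <= W ->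
  `|ln ((y + v) ^+ 2 + (W + d) ^+ 2) - ln (v ^+ 2 + W ^+ 2)
    - (2 * y * v + 2 * d * W) / (v ^+ 2 + W ^+ 2)| <= C / (v ^+ 2 + W ^+ 2)].
Proof.
pose n := y ^+ 2 + d ^+ 2; pose C1 := 8 * n + 2 * n ^+ 2.
have n0 : 0 <= n by rewrite addr_ge0 ?sqr_ge0.
have C10 : 0 <= C1 by rewrite addr_ge0 ?mulr_ge0 ?exprn_ge0.
(* The threshold ensures [xi ^+ 2 <= C1 / r <= 1 / 4], a range where [ln (1 + xi)] differs from [xi]
   by at most [2 * xi ^+ 2]. *)
exists (n + 2 * C1), (1 + 4 * C1); split=> [||v W hW]; [lra|lra|].
set r := v ^+ 2 + W ^+ 2.
have rW : W <= r by rewrite /r; have := sqr_ge0 v; nra.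
have r1 : 1 <= r by lra.
have r0 : 0 < r by lra.
pose l := 2 * y * v + 2 * d * W.
pose xi := (l + n) / r.
have e1 : (y + v) ^+ 2 + (W + d) ^+ 2 = r * (1 + xi).
  by rewrite /xi mulrDr mulr1 mulrCA divff ?gt_eqF// /l /n /r; ring.
have xi2 : xi ^+ 2 <= C1 / r.
  have l2 : l ^+ 2 <= 4 * (n * r).
    by rewrite /l /n /r; have := sqr_ge0 (y * W - d * v); lra.
  have : (l + n) ^+ 2 <= C1 * r.
    have : 0 <= n ^+ 2 * (r - 1) by rewrite mulr_ge0 ?exprn_ge0// subr_ge0.
    by have := sqr_ge0 (l - n); rewrite /C1; lra.
  rewrite /xi expr_div_n ler_pdivrMr ?exprn_gt0// => h.
  by rewrite expr2 mulrA divfK ?gt_eqF.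
have xi4 : xi ^+ 2 <= 1 / 4.
  by apply: le_trans xi2 _; rewrite ler_pdivrMr//; lra.
have xih : `|xi| <= 1 / 2.
  by rewrite -ler_sqr ?nnegrE// real_normK ?num_real//; lra.
have [x1 x2] : - (1 / 2) <= xi /\ xi <= 1 / 2 by move: xih; rewrite ler_norml => /andP[].
have x0 : 0 < 1 + xi by lra.
rewrite e1 lnM ?posrE// (addrC (ln r)) addrK.
have u1 : ln (1 + xi) <= xi by apply: le_ln1Dx; lra.
have u2 : xi - 2 * xi ^+ 2 <= ln (1 + xi).
  have : ln (1 + - xi / (1 + xi)) <= - xi / (1 + xi).
    apply: le_ln1Dx; rewrite mulNr ltrN2 ltr_pdivrMr//; lra.
  have -> : 1 + - xi / (1 + xi) = (1 + xi)^-1 by field; rewrite gt_eqF.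
  rewrite lnV ?posrE// mulNr lerN2; apply: le_trans.
  by rewrite ler_pdivlMr//; nra.
rewrite -/l (_ : l / r = xi - n / r); last by rewrite /xi [(l + n) / r]mulrDl addrK.
have nr : 0 <= n / r by rewrite divr_ge0// ltW.
rewrite [(n + _) / r]mulrDl -[2 * C1 / r]mulrA ler_norml; apply/andP; split; lra.
Qed.

End comparison_bounds.

(** * Summation along the first lattice direction *)

Lemma is_derive_sumf (R : realType) (I : Type) (r : seq I) (h : I -> R -> R)
    (dh : I -> R) (t : R) :
  (forall i, is_derive t 1 (h i) (dh i)) ->
  is_derive t 1 (fun s => \sum_(i <- r) h i s) (\sum_(i <- r) dh i).
Proof.
move=> hd; elim: r => [|i r IH].
  rewrite big_nil (_ : (fun _ => _) = cst 0); first exact: is_derive_cst.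
  by apply/funext => s; rewrite big_nil.
rewrite big_cons (_ : (fun _ => _) = h i + (fun s => \sum_(j <- r) h j s)).
  exact: is_deriveD.
by apply/funext => s; rewrite big_cons.
Qed.

Lemma eventually_uniform (P : finType) (A : P -> nat -> Prop) :
  (forall p, exists m0, forall m, (m0 <= m)%N -> A p m) ->
  exists m0, forall m, (m0 <= m)%N -> forall p, A p m.
Proof.
move=> h; exists (\max_p projT1 (cid (h p))) => m mm p.
apply: (projT2 (cid (h p))); apply: leq_trans mm.
exact: (@leq_bigmax _ (fun p => projT1 (cid (h p)))).
Qed.

Lemma atan_ge (R : realType) (s : R) : 0 < s -> pi / 2 - s^-1 <= atan s.
Proof.
move=> s0; rewrite lerBlDr; apply/ler_addgt0Pr => e e0.
have /cvgrPdist_le /(_ e e0) [M [_ hM]] := @cvgy_atan R.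
pose S := Num.max s (M + 1).
have sS : s <= S by rewrite le_max lexx.
have /hM : M < S by rewrite lt_max ltrDl ltr01 orbT.
rewrite ler_norml => /andP[_ h].
have : `|atan S - atan s| <= - S^-1 - - s^-1.
  apply: (@ler_diff_majorant _ _ (fun t => (1 + t ^+ 2)^-1) (fun t => - t^-1)
    (fun t => (t ^+ 2)^-1)) => // t /andP[st _].
    have t0 : t != 0 by rewrite gt_eqF//; lra.
    have dV : is_derive t 1 (fun y : R => y^-1) (- t ^- 2 *: 1).
      exact: is_deriveV t0 (is_derive_id t 1).
    have h2 := is_deriveN dV.
    by apply: is_derive_eq h2 _; rewrite /GRing.scale /=; field.
  have t0 : 0 < t by lra.
  have t2 : 0 < t ^+ 2 by rewrite exprn_gt0.
  rewrite ger0_norm ?invr_ge0 ?addr_ge0 ?(ltW t2)//.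
  by rewrite lef_pV2 ?posrE// ?lerDr// addr_gt0.
have : 0 < S^-1 by rewrite invr_gt0; lra.
by rewrite ler_norml => ? /andP[_]; lra.
Qed.

Section axis_sums.
Context {R : realType} {P : finType}.
Variables (L c : R) (Q X : P -> R).
Hypotheses (c0 : 0 < c) (cL : c * L = 2 * pi).
Hypothesis Q0 : \sum_p Q p = 0.
Implicit Types (a : P -> R) (m : nat).

(* The bound is uniform in the number of nodes, which allows to exchange the limits
   [m -> oo] and [T -> oo] in [axis_sum_log]. *)
Lemma neutral_recip_le a : exists2 C, 0 <= C & forall m t, 1 <= t ->
  `|\sum_(k < 2 ^ m.+1) \sum_p
     Q p * ((X p + node L m k) ^+ 2 + (a p ^+ 2 + t ^+ 2))^-1| <= C / t ^+ 2.
Proof.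
have [C hC0 hC] : exists2 C : P -> R, (forall p, 0 <= C p) &
    forall p u t, 1 <= t ->
    `|((X p + u) ^+ 2 + (a p ^+ 2 + t ^+ 2))^-1 - (u ^+ 2 + t ^+ 2)^-1|
      <= C p / t * (u ^+ 2 + t ^+ 2)^-1.
  have h p := recip_shift_le (X p) (a p).
  exists (fun p => s2val (cid2 (h p))) => p; first exact: (s2valP (cid2 (h p))).
  exact: (s2valP' (cid2 (h p))).
have [C2 C20 hC2] := node_sum_le c0 cL ltr01.
pose C1 := \sum_p `|Q p| * C p.
have C10 : 0 <= C1 by rewrite sumr_ge0// => p _; rewrite mulr_ge0.
exists (C1 * C2) => [|m t t1]; first by rewrite mulr_ge0// ltW.
have t0 : 0 < t by lra.
apply: le_trans (ler_norm_sum _ _ _) _.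
apply: (@le_trans _ _ (\sum_(k < 2 ^ m.+1) C1 / t * ((0 + node L m k) ^+ 2 + t ^+ 2)^-1)).
  apply: ler_sum => k _; set u := node L m k; rewrite add0r.
  have -> : \sum_p Q p * ((X p + u) ^+ 2 + (a p ^+ 2 + t ^+ 2))^-1 =
     \sum_p Q p * (((X p + u) ^+ 2 + (a p ^+ 2 + t ^+ 2))^-1 - (u ^+ 2 + t ^+ 2)^-1).
    under [RHS]eq_bigr do rewrite mulrBr.
    by rewrite sumrB -mulr_suml Q0 mul0r subr0.
  apply: le_trans (ler_norm_sum _ _ _) _.
  rewrite /C1 !mulr_suml; apply: ler_sum => p _.
  by rewrite normrM -!mulrA ler_wpM2l// mulrA hC.
rewrite -mulr_sumr (_ : C1 * C2 / t ^+ 2 = C1 / t * (C2 / t)); last first.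
  by field; rewrite gt_eqF.
by rewrite ler_wpM2l ?divr_ge0 ?(ltW t0)// hC2.
Qed.

Lemma is_derive_atan_sum a m (t : R) : (forall p, 0 < a p) ->
  is_derive t 1 (fun T : R => \sum_(k < 2 ^ m.+1) \sum_p
    Q p * (atan (T / Num.sqrt ((X p + node L m k) ^+ 2 + a p ^+ 2))
           / Num.sqrt ((X p + node L m k) ^+ 2 + a p ^+ 2)))
  (\sum_(k < 2 ^ m.+1) \sum_p
     Q p * ((X p + node L m k) ^+ 2 + (a p ^+ 2 + t ^+ 2))^-1).
Proof.
move=> a0; apply: is_derive_sumf => k; apply: is_derive_sumf => p.
have r0 : 0 < (X p + node L m k) ^+ 2 + a p ^+ 2.
  by rewrite ltr_wpDl ?sqr_ge0 ?exprn_gt0.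
set b := Num.sqrt _.
have b0 : 0 < b by rewrite sqrtr_gt0.
rewrite addrA -[X in X + t ^+ 2]sqr_sqrtr ?(ltW r0)// -/b.
by have := is_derive_atan_div t b0; exact: is_deriveZ.
Qed.

Lemma atan_sum_tail a : (forall p, 0 < a p) -> exists2 C, 0 <= C & forall m T, 1 <= T ->
  `|\sum_(k < 2 ^ m.+1) \sum_p
      Q p * (pi / 2 / Num.sqrt ((X p + node L m k) ^+ 2 + a p ^+ 2))
    - \sum_(k < 2 ^ m.+1) \sum_p
    Q p * (atan (T / Num.sqrt ((X p + node L m k) ^+ 2 + a p ^+ 2))
           / Num.sqrt ((X p + node L m k) ^+ 2 + a p ^+ 2))| <= C / T.
Proof.
move=> a0; have [C C0 hC] := neutral_recip_le a; exists C => // m T T1.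
set S := (X in `|X - _|).
pose F T := \sum_(k < 2 ^ m.+1) \sum_p
    Q p * (atan (T / Num.sqrt ((X p + node L m k) ^+ 2 + a p ^+ 2))
           / Num.sqrt ((X p + node L m k) ^+ 2 + a p ^+ 2)).
rewrite -/(F T).
(* This bound grows with the number of nodes; it only lets [T2] tend to infinity at fixed [m]. The
   uniform rate comes from the interval between [T] and [T2]. *)
pose N := (2 ^ m.+1)%:R * \sum_p `|Q p|.
have N0 : 0 <= N by rewrite mulr_ge0// sumr_ge0.
have SF T2 : 0 < T2 -> `|S - F T2| <= N / T2.
  move=> T20; rewrite -sumrB; apply: le_trans (ler_norm_sum _ _ _) _.
  have -> : N / T2 = \sum_(k < 2 ^ m.+1) (\sum_p `|Q p|) / T2.
    by rewrite sumr_const card_ord -[RHS]mulr_natl mulrA.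
  apply: ler_sum => k _; rewrite -sumrB mulr_suml.
  apply: le_trans (ler_norm_sum _ _ _) _; apply: ler_sum => p _.
  rewrite -mulrBr normrM ler_wpM2l//.
  have b0 : 0 < Num.sqrt ((X p + node L m k) ^+ 2 + a p ^+ 2).
    by rewrite sqrtr_gt0 ltr_wpDl ?sqr_ge0 ?exprn_gt0.
  move: (Num.sqrt _) b0 => b b0.
  have Tb : 0 < T2 / b by rewrite divr_gt0.
  have h1 := atan_ge Tb; have h2 := ltW (atan_ltpi2 (T2 / b)).
  rewrite -mulrBl ger0_norm ?divr_ge0 ?subr_ge0 ?(ltW b0)//.
  by rewrite ler_pdivrMr//; move: h1; rewrite invf_div mulrC; lra.
apply/ler_addgt0Pr => e e0.
pose T2 := Num.max T (N / e + 1).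
have TT : T <= T2 by rewrite le_max lexx.
have T20 : 0 < T2 by lra.
have T2e : N / T2 <= e.
  rewrite ler_pdivrMr// mulrC -ler_pdivrMr//.
  by rewrite le_max; apply/orP; right; rewrite lerDl.
have : `|F T2 - F T| <= - (C / T2) - - (C / T).
  apply: (@ler_diff_majorant _ F _ (fun t => - (C / t)) (fun t => C / t ^+ 2)) => //.
  - by move=> t _; exact: is_derive_atan_sum.
  - move=> t /andP[tT _]; have t0 : t != 0 by rewrite gt_eqF//; lra.
    have dV : is_derive t 1 (fun y : R => y^-1) (- t ^- 2 *: 1).
      exact: is_deriveV t0 (is_derive_id t 1).
    have h2 := is_deriveN (is_deriveZ C dV).
    by apply: is_derive_eq h2 _; rewrite /GRing.scale /=; field.
  - by move=> t /andP[tT _]; apply: hC; lra.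
have CT : 0 <= C / T2 by rewrite divr_ge0// ltW.
have := SF _ T20; have := ler_distD (F T2) S (F T).
lra.
Qed.

End axis_sums.

(** All terms grow like ln (2 T), which neutrality allows to subtract; each remainder is O(a p /
    T). *)
Lemma asinh_sum_le (R : realType) (P : finType) (Q a : P -> R) :
  \sum_p Q p = 0 -> (forall p, 0 < a p) -> exists2 C, 0 <= C & forall T, 1 <= T ->
  `|\sum_p Q p * ln (T + Num.sqrt (T ^+ 2 + a p ^+ 2))| <= C / T.
Proof.
move=> Q0 a0; exists (\sum_p `|Q p| * a p) => [|T T1].
  by rewrite sumr_ge0// => p _; rewrite mulr_ge0// ltW.
have T0 : 0 < T by lra.
have -> : \sum_p Q p * ln (T + Num.sqrt (T ^+ 2 + a p ^+ 2)) =
   \sum_p Q p * (ln (T + Num.sqrt (T ^+ 2 + a p ^+ 2)) - ln (2 * T)).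
  under [RHS]eq_bigr do rewrite mulrBr.
  by rewrite sumrB -mulr_suml Q0 mul0r subr0.
apply: le_trans (ler_norm_sum _ _ _) _; rewrite mulr_suml; apply: ler_sum => p _.
rewrite normrM -mulrA ler_wpM2l//.
have a0p := a0 p; set A := Num.sqrt _.
have A2 : A ^+ 2 = T ^+ 2 + a p ^+ 2 by rewrite sqr_sqrtr// addr_ge0 ?sqr_ge0.
have A0 : 0 <= A by rewrite sqrtr_ge0.
have TA : T <= A by rewrite -ler_sqr ?nnegrE ?(ltW T0)// A2 lerDl sqr_ge0.
have AT : A <= T + a p.
  by rewrite -ler_sqr ?nnegrE ?A2//; [nra|lra].
rewrite -ln_div ?posrE ?mulr_gt0//; last by lra.
have -> : (T + A) / (2 * T) = 1 + (A - T) / (2 * T) by field; rewrite gt_eqF.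
have q0 : 0 <= (A - T) / (2 * T) by rewrite divr_ge0 ?subr_ge0// mulr_ge0// ltW.
rewrite ger0_norm ?ln_ge0 ?lerDl//; apply: le_trans (le_ln1Dx _) _; first lra.
rewrite ler_pdivrMr ?mulr_gt0// mulrACA [T^-1 * _]mulrC mulrA.
rewrite (_ : _ / T = 2 * a p); last by field; rewrite gt_eqF.
lra.
Qed.

Section axis_asymptotics.
Context {R : realType} {P : finType}.
Variables (L c d : R) (Q X : P -> R).
Hypotheses (c0 : 0 < c) (cL : c * L = 2 * pi) (d0 : 0 < d).
Hypothesis Q0 : \sum_p Q p = 0.

Lemma node_sum_asymp : exists2 C, 0 < C & forall p (u w t : R), d <= w ->
  exists m0, forall m, (m0 <= m)%N -> forall s : R, 0 <= s <= t ->
  `|\sum_(k < 2 ^ m.+1) ((X p + node L m k) ^+ 2 + (u ^+ 2 + w ^+ 2 + s ^+ 2))^-1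
    - c / 2 / Num.sqrt (u ^+ 2 + w ^+ 2 + s ^+ 2)|
  <= C * (expR (- (c * w)) * (w / (w + u ^+ 2)) * (w + s ^+ 2)^-1) + C / 2 ^+ m.
Proof.
have [C1 C10 hC1] := node_sum_kernel c0 cL.
have [C2 C20 hC2] := periodic_kernel_sub1 (mulr_gt0 c0 d0).
have [C3 C30 hC3] := exp_sqrt_div_le c0 d0.
pose M := c / 2 * C2 * C3.
have M0 : 0 < M by rewrite !mulr_gt0// divr_gt0.
exists (M + C1) => [|p u w t dw]; first exact: addr_gt0.
have w0 : 0 < w := lt_le_trans d0 dw.
have [m0 hm0] := hC1 (X p).
have [m1 hm1] := exp2_ge (c * Num.sqrt (u ^+ 2 + w ^+ 2 + t ^+ 2)).
exists (maxn m0 m1) => m; rewrite geq_max => /andP[mm0 mm1] s /andP[s0 st].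
have q0 : 0 < u ^+ 2 + w ^+ 2 + s ^+ 2.
  by rewrite ltr_pwDl ?sqr_ge0// ltr_wpDl ?sqr_ge0 ?exprn_gt0.
set A := Num.sqrt (u ^+ 2 + w ^+ 2 + s ^+ 2).
have A0 : 0 < A by rewrite sqrtr_gt0.
have A2 : A ^+ 2 = u ^+ 2 + w ^+ 2 + s ^+ 2 by rewrite sqr_sqrtr// ltW.
have wA : w <= A.
  rewrite -ler_sqr ?nnegrE ?(ltW w0) ?(ltW A0)// A2.
  by have := sqr_ge0 u; have := sqr_ge0 s; lra.
have cA : c * A <= 2 ^+ m.
  apply: le_trans (hm1 _ mm1); rewrite ler_pM2l// ler_wsqrtr// lerD2l.
  by rewrite ler_sqr ?nnegrE//; lra.
have := hm0 m mm0 A A0 cA; rewrite A2.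
set S := \sum_(k < _) _; set K := periodic_kernel _ _ => h1.
have h2 : `|K - 1| <= C2 * expR (- (c * A)) by apply: hC2; rewrite ler_pM2l//; lra.
have h3 := hC3 w u s A dw (ltW A0) A2.
have h4 : `|c / 2 / A * K - c / 2 / A| <= M * (expR (- (c * w)) * (w / (w + u ^+ 2)) / (w + s ^+ 2)).
  have c2 : 0 < c / 2 by rewrite divr_gt0.
  rewrite (_ : _ - _ = c / 2 * (K - 1) / A); last by field; rewrite gt_eqF.
  rewrite normrM normfV (gtr0_norm A0) normrM (gtr0_norm c2).
  apply: (@le_trans _ _ (c / 2 * C2 * (expR (- (c * A)) / A))).
    by rewrite !mulrA ler_pM2r ?invr_gt0// -[leRHS]mulrA ler_pM2l.
  rewrite /M -[in leRHS]mulrA ler_pM2l ?mulr_gt0//.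
  by apply: le_trans h3 _; rewrite !mulrA.
have e0 : 0 <= expR (- (c * w)) * (w / (w + u ^+ 2)) / (w + s ^+ 2).
  by rewrite !mulr_ge0 ?invr_ge0 ?addr_ge0 ?sqr_ge0 ?expR_ge0 ?(ltW w0).
have e1 : 0 <= C1 * (expR (- (c * w)) * (w / (w + u ^+ 2)) / (w + s ^+ 2)).
  by rewrite mulr_ge0// ltW.
have e2 : 0 <= M / 2 ^+ m by rewrite divr_ge0 ?exprn_ge0// ltW.
have := ler_distD (c / 2 / A * K) S (c / 2 / A).
rewrite !mulrDl; lra.
Qed.

Lemma axis_sum_log : exists2 C, 0 < C & forall u w : P -> R, (forall p, d <= w p) ->
  forall e, 0 < e -> exists m0, forall m, (m0 <= m)%N ->
  `|\sum_(k < 2 ^ m.+1) \sum_p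
      Q p / Num.sqrt ((X p + node L m k) ^+ 2 + u p ^+ 2 + w p ^+ 2)
    + c / (2 * pi) * \sum_p Q p * ln (u p ^+ 2 + w p ^+ 2)|
  <= C * \sum_p `|Q p| * (expR (- (c * w p)) * (Num.sqrt (w p) / (w p + u p ^+ 2))) + e.
Proof.
have [C C0 hC] := node_sum_asymp.
have pi0 := pi_gt0 R; have pi2 := pi_ge2 R; have pi4 := pihalf_lt2 R.
(* Integrating [(w p + t ^+ 2)^-1] gives at most pi / (2 sqrt (w p)): hence the factor 2 > pi / 2,
   and [Num.sqrt (w p)] in place of [w p]. *)
exists (2 * C) => [|u w dw e e0]; first by rewrite mulr_gt0.
have w0 p : 0 < w p := lt_le_trans d0 (dw p).
have q0 p : 0 < u p ^+ 2 + w p ^+ 2 by rewrite ltr_wpDl ?sqr_ge0 ?exprn_gt0.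
pose a p := Num.sqrt (u p ^+ 2 + w p ^+ 2).
have a0 p : 0 < a p by rewrite sqrtr_gt0.
have a2 p : a p ^+ 2 = u p ^+ 2 + w p ^+ 2 by rewrite sqr_sqrtr// ltW.
have [C1 C10 hC1] := atan_sum_tail X c0 cL Q0 a0.
have [C2 C20 hC2] := asinh_sum_le Q0 a0.
(* [T] precedes [m] because the node error [C / 2 ^+ m] gets multiplied by the length [T] of
   integration. *)
pose T := Num.max 1 ((C1 + c / 2 * C2) / (e / 2)).
have T1 : 1 <= T by rewrite le_max lexx.
have T0 : 0 < T by lra.
have hT : C1 / T + c / 2 * (C2 / T) <= e / 2.
  rewrite mulrA -mulrDl ler_pdivrMr// [leRHS]mulrC -ler_pdivrMr ?divr_gt0//.
  by rewrite le_max lexx orbT.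
pose q := \sum_p `|Q p|.
have q00 : 0 <= q by rewrite sumr_ge0.
have [m0 hm0] := eventually_uniform (fun p => hC p (u p) (w p) T (dw p)).
have [m1 hm1] := exp2_ge (q * C * T / (e / 2)).
exists (maxn m0 m1) => m; rewrite geq_max => /andP[mm0 mm1].
have N0 : 0 < 2 ^+ m :> R by rewrite exprn_gt0.
have hN : q * C * T / 2 ^+ m <= e / 2.
  by rewrite ler_pdivrMr// [leRHS]mulrC -ler_pdivrMr ?divr_gt0// hm1.
pose F T := \sum_(k < 2 ^ m.+1) \sum_p
    Q p * (atan (T / Num.sqrt ((X p + node L m k) ^+ 2 + a p ^+ 2))
           / Num.sqrt ((X p + node L m k) ^+ 2 + a p ^+ 2)).
pose F' t := \sum_(k < 2 ^ m.+1) \sum_p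
     Q p * ((X p + node L m k) ^+ 2 + (a p ^+ 2 + t ^+ 2))^-1.
pose G T := \sum_p Q p * (c / 2 * ln (T + Num.sqrt (T ^+ 2 + a p ^+ 2))).
pose G' t := \sum_p Q p * (c / 2 * (Num.sqrt (t ^+ 2 + a p ^+ 2))^-1).
pose W p := C * (expR (- (c * w p)) * (w p / (w p + u p ^+ 2))).
pose B T := \sum_p `|Q p| * (W p * (atan (T / Num.sqrt (w p)) / Num.sqrt (w p))
   + C / 2 ^+ m * T).
pose B' t := \sum_p `|Q p| * (W p * (Num.sqrt (w p) ^+ 2 + t ^+ 2)^-1
   + C / 2 ^+ m).
have main : `|(F T - G T) - (F 0 - G 0)| <= B T - B 0.
  apply: (@ler_diff_majorant _ (fun t => F t - G t) (fun t => F' t - G' t) B B');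
      first exact: ltW.
  - move=> t _; have dF : is_derive t 1 F (F' t) by exact: is_derive_atan_sum.
    apply: is_deriveB; apply: is_derive_sumf => p; apply: is_deriveZ.
    by apply: is_deriveZ; exact: is_derive_asinh.
  - move=> t _; apply: is_derive_sumf => p; apply: is_deriveZ.
    apply: is_deriveD.
      by apply: is_deriveZ; apply: is_derive_atan_div; rewrite sqrtr_gt0.
    by apply: is_derive_eq; rewrite /GRing.scale /=; ring.
  - move=> t tT; rewrite /F' exchange_big /= /G' -sumrB /B'.
    apply: le_trans (ler_norm_sum _ _ _) _; apply: ler_sum => p _.
    rewrite -mulr_sumr -mulrBr normrM ler_wpM2l//.
    have := hm0 m mm0 p t tT.
    rewrite sqr_sqrtr ?(ltW (w0 p))// a2 [t ^+ 2 + _]addrC /W.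
    by rewrite !mulrA.
have F00 : F 0 = 0.
  rewrite /F big1// => k _; rewrite big1// => p _.
  by rewrite mul0r atan0 mul0r mulr0.
have G00 : G 0 = c / 4 * \sum_p Q p * ln (u p ^+ 2 + w p ^+ 2).
  rewrite /G mulr_sumr; apply: eq_bigr => p _.
  rewrite expr0n/= !add0r sqrtr_sqr (gtr0_norm (a0 p)) -a2 lnXn//.
  by rewrite -mulr_natr; field.
have GT : `|G T| <= c / 2 * (C2 / T).
  have -> : G T = c / 2 * \sum_p Q p * ln (T + Num.sqrt (T ^+ 2 + a p ^+ 2)).
    by rewrite /G mulr_sumr; apply: eq_bigr => p _; rewrite mulrCA.
  by rewrite normrM gtr0_norm ?divr_gt0// ler_pM2l ?divr_gt0// hC2.
have BT : B T - B 0 <=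
    2 * C * (\sum_p `|Q p| * (expR (- (c * w p)) * (Num.sqrt (w p) / (w p + u p ^+ 2)))) + e / 2.
  have -> : B 0 = 0.
    by rewrite /B big1// => p _; rewrite mul0r atan0 mul0r !mulr0 addr0 mulr0.
  rewrite subr0; have -> : B T = \sum_p `|Q p| * (W p * (atan (T / Num.sqrt (w p)) / Num.sqrt (w p)))
     + q * C * T / 2 ^+ m.
    rewrite /B -!mulrA mulr_suml -big_split /=; apply: eq_bigr => p _.
    by rewrite mulrDr; congr (_ + _); field; rewrite gt_eqF.
  rewrite lerD// mulr_sumr; apply: ler_sum => p _.
  have s0 : 0 < Num.sqrt (w p) by rewrite sqrtr_gt0.
  have uw0 : 0 < w p + u p ^+ 2 by rewrite ltr_pwDl// sqr_ge0.
  rewrite [leRHS]mulrCA ler_wpM2l//.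
  rewrite /W -{2}[w p](@sqr_sqrtr _ (w p)) ?(ltW (w0 p))//.
  have Z0 : 0 < C * (expR (- (c * w p)) * (Num.sqrt (w p) / (w p + u p ^+ 2))).
    by rewrite !mulr_gt0 ?expR_gt0 ?invr_gt0.
  rewrite [leLHS](_ : _ = C * (expR (- (c * w p)) * (Num.sqrt (w p) / (w p + u p ^+ 2)))
    * atan (T / Num.sqrt (w p))); last first.
    move: (expR _) (atan _) => E1 E2; move: (Num.sqrt _) s0 => s s0.
    by field; rewrite !gt_eqF.
  rewrite -[leRHS]mulrA [leRHS]mulrC ler_pM2l//.
  by have := atan_ltpi2 (T / Num.sqrt (w p)); lra.
have := hC1 m T T1; rewrite -/(F T).
set S1 := \sum_(k < _) _ => hS1.
set S := \sum_(k < _) _.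
have SS1 : S1 = pi / 2 * S.
  rewrite /S1 /S mulr_sumr; apply: eq_bigr => k _.
  rewrite mulr_sumr; apply: eq_bigr => p _.
  by rewrite a2 addrA mulrCA mulrA.
move: main; rewrite F00 sub0r opprK => main.
have key : `|S1 + G 0| <= 2 * C * (\sum_p `|Q p| *
    (expR (- (c * w p)) * (Num.sqrt (w p) / (w p + u p ^+ 2)))) + e.
  have -> : S1 + G 0 = (S1 - F T) + (F T - G T + G 0) + G T by ring.
  apply: le_trans (ler_normD _ _) _; apply: le_trans (lerD (ler_normD _ _) (lexx _)) _.
  lra.
apply: le_trans key; rewrite G00 SS1.
have cpi x : 0 < x -> c / (2 * x) = 2 / x * (c / 4) by move=> x0; field; rewrite gt_eqF.
have e1 : 2 / pi * (pi / 2) = 1 :> R by rewrite mulrA divfK ?gt_eqF// divff.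
rewrite cpi//.
have S2 : S = 2 / pi * (pi / 2 * S) by rewrite [RHS]mulrA e1 mul1r.
set Z := \sum_p _ * ln _.
have -> : S + 2 / pi * (c / 4) * Z = 2 / pi * (pi / 2 * S + c / 4 * Z).
  by rewrite [RHS]mulrDr -S2 [in RHS]mulrA.
rewrite normrM ler_piMl// ger0_norm ?divr_ge0 ?(ltW pi0)//.
by rewrite ler_pdivrMr// mul1r.
Qed.

End axis_asymptotics.

(** * Neutral lattice sums *)

Section neutral_lattice.
Context {R : realType} {P : finType}.
Variables (d : R) (Q X Y D : P -> R).
Hypotheses (d0 : 0 < d) (dD : forall p, d <= D p).
Hypotheses (Q0 : \sum_p Q p = 0) (QY0 : \sum_p Q p * Y p = 0)
  (QD0 : \sum_p Q p * D p = 0).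

(** Vanishing charge and first moments cancel the leading terms of [ln_shift_le]. The rest, summed
    over the second direction, is O(1 / W), so the logarithmic sum vanishes at infinite height. *)
Lemma neutral_ln_le : exists C W0 : R, [/\ 0 <= C, 1 <= W0 & forall v W, W0 <= W ->
  `|\sum_p Q p * ln ((Y p + v) ^+ 2 + (W + D p) ^+ 2)| <= C * (v ^+ 2 + W ^+ 2)^-1].
Proof.
have [C hC] : exists C : P -> R * R, forall p, [/\ 0 <= (C p).1, 1 <= (C p).2 &
    forall v W, (C p).2 <= W ->
    `|ln ((Y p + v) ^+ 2 + (W + D p) ^+ 2) - ln (v ^+ 2 + W ^+ 2)
    - (2 * Y p * v + 2 * D p * W) / (v ^+ 2 + W ^+ 2)| <= (C p).1 / (v ^+ 2 + W ^+ 2)].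
  have h p : exists C : R * R, [/\ 0 <= C.1, 1 <= C.2 &
    forall v W, C.2 <= W ->
    `|ln ((Y p + v) ^+ 2 + (W + D p) ^+ 2) - ln (v ^+ 2 + W ^+ 2)
    - (2 * Y p * v + 2 * D p * W) / (v ^+ 2 + W ^+ 2)| <= C.1 / (v ^+ 2 + W ^+ 2)].
    by have [C [W0 h]] := ln_shift_le (Y p) (D p); exists (C, W0).
  by exists (fun p => projT1 (cid (h p))) => p; exact: (projT2 (cid (h p))).
have W1 p : 1 <= (C p).2 by have [] := hC p.
have C1 p : 0 <= (C p).1 by have [] := hC p.
exists (\sum_p `|Q p| * (C p).1), (1 + \sum_p (C p).2); split.
- by rewrite sumr_ge0// => p _; rewrite mulr_ge0.
- by rewrite lerDl sumr_ge0// => p _; have := W1 p; lra.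
move=> v W hW; set r := v ^+ 2 + W ^+ 2.
have -> : \sum_p Q p * ln ((Y p + v) ^+ 2 + (W + D p) ^+ 2) =
  \sum_p Q p * (ln ((Y p + v) ^+ 2 + (W + D p) ^+ 2) - ln r
    - (2 * Y p * v + 2 * D p * W) / r).
  have e p : Q p * (ln ((Y p + v) ^+ 2 + (W + D p) ^+ 2) - ln r
    - (2 * Y p * v + 2 * D p * W) / r) =
    Q p * ln ((Y p + v) ^+ 2 + (W + D p) ^+ 2) - Q p * ln r
    - (Q p * Y p * (2 * v / r) + Q p * D p * (2 * W / r)) by ring.
  under [RHS]eq_bigr do rewrite e.
  by rewrite !sumrB big_split /= -!mulr_suml Q0 QY0 QD0 !mul0r addr0 !subr0.
apply: le_trans (ler_norm_sum _ _ _) _; rewrite mulr_suml; apply: ler_sum => p _.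
rewrite normrM -[leRHS]mulrA ler_wpM2l//; have [_ _] := hC p; apply.
apply: le_trans hW; rewrite (bigD1 p)//=.
have : 0 <= \sum_(i | i != p) (C i).2.
  by rewrite sumr_ge0// => i _; have := W1 i; lra.
lra.
Qed.

Lemma neutral_ln_sum L c : 0 < c -> c * L = 2 * pi -> exists2 C, 0 <= C &
  forall (V e : R), 0 <= V -> 0 < e -> exists m0, forall m, (m0 <= m)%N ->
  `|\sum_(k < 2 ^ m.+1) \sum_p
     Q p * ln ((Y p + node L m k) ^+ 2 + (V + D p) ^+ 2)| <= C * expR (- (c * V)) + e.
Proof.
move=> c0 cL.
have D0 p : 0 < D p := lt_le_trans d0 (dD p).
have [C1 [W0 [C10 W01 hC1]]] := neutral_ln_le.
have [C2 C20 hC2] := node_sum_le c0 cL ltr01.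
have [C3 C30 hC3] := node_sum_kernel c0 cL.
have [C4 C40 hC4] := periodic_kernel_sub1 (mulr_gt0 c0 d0).
pose q := \sum_p `|Q p|.
have q0 : 0 <= q by rewrite sumr_ge0.
exists (q * C4) => [|V e V0 e0]; first by rewrite mulr_ge0// ltW.
(* [V1] stands for infinite height: the sum there is at most [e / 2], so bounding the derivative on
   [V, V1] bounds the sum at [V]. *)
pose V1 := Num.max (Num.max V W0) (C1 * C2 / (e / 2)).
have VV1 : V <= V1 by rewrite /V1 !le_max lexx.
have WV1 : W0 <= V1 by rewrite /V1 !le_max lexx orbT.
have V1e : C1 * C2 / V1 <= e / 2.
  rewrite ler_pdivrMr; last by lra.
  by rewrite [leRHS]mulrC -ler_pdivrMr ?divr_gt0// /V1 le_max lexx orbT.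
have [m0 hm0] := eventually_uniform (fun p => hC3 (Y p)).
have [m1 hm1] := eventually_uniform (fun p => exp2_ge (c * (V1 + D p))).
pose M := \sum_p `|Q p| * (2 * (V1 + D p) * C3).
have [m2 hm2] := exp2_ge (M * V1 / (e / 2)).
exists (maxn m0 (maxn m1 m2)) => m; rewrite !geq_max => /and3P[mm0 mm1 mm2].
have N0 : 0 < 2 ^+ m :> R by rewrite exprn_gt0.
have hN : M * V1 / 2 ^+ m <= e / 2.
  by rewrite ler_pdivrMr// [leRHS]mulrC -ler_pdivrMr ?divr_gt0// hm2.
have M0 : 0 <= M.
  rewrite sumr_ge0// => p _; rewrite !mulr_ge0 ?(ltW C30)//.
  by rewrite addr_ge0 ?(ltW (D0 p))//; lra.
pose g W := \sum_(k < 2 ^ m.+1) \sum_p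
   Q p * ln ((Y p + node L m k) ^+ 2 + (W + D p) ^+ 2).
pose g' W := \sum_(k < 2 ^ m.+1) \sum_p
   Q p * (2 * (W + D p) * ((Y p + node L m k) ^+ 2 + (W + D p) ^+ 2)^-1).
pose B W := - (q * C4 * expR (- c * W)) + M / 2 ^+ m * W.
pose B' W := q * C4 * c * expR (- c * W) + M / 2 ^+ m.
have main : `|g V1 - g V| <= B V1 - B V.
  apply: (@ler_diff_majorant _ g g' B B') => //.
  - move=> W /andP[VW _]; apply: is_derive_sumf => k; apply: is_derive_sumf => p.
    apply: is_deriveZ; apply: is_derive_ln_sqr; have := D0 p; lra.
  - move=> W _; have h1 := is_derive_expRM (- c) W.
    have h2 := is_deriveN (is_deriveZ (q * C4) h1).
    have h3 := is_deriveZ (M / 2 ^+ m) (is_derive_id W 1).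
    by apply: is_derive_eq (is_deriveD h2 h3) _; rewrite /B' /GRing.scale /=; ring.
  - move=> W /andP[VW WV].
    have Dc : \sum_p Q p * c = 0 by rewrite -mulr_suml Q0 mul0r.
    rewrite /g' exchange_big /= -[X in `|X|]subr0 -[X in _ - X]Dc -sumrB.
    have -> : B' W = \sum_p `|Q p| * (C4 * c * expR (- c * W) + 2 * (V1 + D p) * C3 / 2 ^+ m).
      rewrite /B' /q /M !mulr_suml -big_split /=; apply: eq_bigr => p _.
      by move: (expR _) => E; field; rewrite gt_eqF.
    apply: le_trans (ler_norm_sum _ _ _) _; apply: ler_sum => p _.
    rewrite -mulr_sumr -mulrBr normrM ler_wpM2l// -mulr_sumr.
    set S := \sum_(k < _) _; set a := W + D p.
    have Dp := D0 p; have a0 : 0 < a by rewrite /a; lra.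
    have ca : c * a <= 2 ^+ m.
      by apply: le_trans (hm1 m mm1 p); rewrite ler_pM2l// lerD2r.
    have := hm0 m mm0 p a a0 ca.
    have := hC4 (c * Y p) (c * a); rewrite ler_pM2l// => /(_ _).
    have da : d <= a by have := dD p; rewrite /a; lra.
    move=> /(_ da); rewrite -/S; set K := periodic_kernel _ _ => hK hS.
    have E : expR (- (c * a)) <= expR (- c * W).
      by rewrite ler_expR mulNr lerN2 ler_pM2l// lerDl ltW.
    have -> : 2 * a * S - c = 2 * a * (S - c / 2 / a * K) + c * (K - 1).
      by field; rewrite gt_eqF.
    apply: le_trans (ler_normD _ _) _; rewrite addrC lerD//.
      rewrite normrM (gtr0_norm c0) -mulrA mulrCA ler_pM2l//.
      by apply: le_trans hK _; rewrite ler_pM2l.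
    have a2 : 0 < 2 * a by rewrite mulr_gt0.
    rewrite normrM (gtr0_norm a2) -[leRHS]mulrA ler_pM//; first exact: ltW.
    by rewrite ler_pM2l// lerD2r.
have gV1 : `|g V1| <= C1 * C2 / V1.
  apply: le_trans (ler_norm_sum _ _ _) _.
  apply: (@le_trans _ _ (\sum_(k < 2 ^ m.+1) C1 * ((0 + node L m k) ^+ 2 + V1 ^+ 2)^-1)).
    by apply: ler_sum => k _; rewrite add0r; exact: hC1.
  by rewrite -mulr_sumr -mulrA ler_wpM2l// hC2//; lra.
have BV : B V1 - B V <= q * C4 * expR (- (c * V)) + e / 2.
  have h1 : 0 <= q * C4 * expR (- c * V1) by rewrite !mulr_ge0 ?expR_ge0// ltW.
  have h2 : 0 <= M / 2 ^+ m * V by rewrite mulr_ge0// divr_ge0// ltW.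
  by rewrite /B (mulNr c V); move: hN; rewrite mulrAC; lra.
rewrite -/(g V).
have : `|g V| <= `|g V1 - g V| + `|g V1|.
  by rewrite -[X in `|X| <= _](subKr (g V1)) (le_trans (ler_normB _ _))// addrC.
lra.
Qed.

(** The error of the rows decays at rate [cx], the sum of their logarithmic main terms at rate [cy];
    the slower rate survives. *)
Lemma neutral_lattice_sum Lx Ly cx cy :
  0 < cx -> cx * Lx = 2 * pi -> 0 < cy -> cy * Ly = 2 * pi ->
  exists2 C, 0 <= C & forall (V e : R), 0 <= V -> 0 < e ->
  exists m0, forall m, (m0 <= m)%N -> exists n0, forall n, (n0 <= n)%N ->
  `|\sum_(k < 2 ^ m.+1) \sum_(l < 2 ^ n.+1) \sum_p
      Q p / Num.sqrt ((X p + node Lx n l) ^+ 2 + (Y p + node Ly m k) ^+ 2 + (V + D p) ^+ 2)|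
  <= C * expR (- (Num.min cx cy * V)) + e.
Proof.
move=> cx0 cxL cy0 cyL; set c := Num.min cx cy.
have [C1 C10 hC1] := axis_sum_log X cx0 cxL d0 Q0.
have [C2 C20 hC2] := neutral_ln_sum cy0 cyL.
have sd0 : 0 < Num.sqrt d by rewrite sqrtr_gt0.
have [C3 C30 hC3] := node_sum_le cy0 cyL sd0.
pose q := \sum_p `|Q p|.
have q0 : 0 <= q by rewrite sumr_ge0.
have pi0 := pi_gt0 R.
pose f := cx / (2 * pi).
have f0 : 0 < f by rewrite divr_gt0// mulr_gt0.
exists (f * C2 + C1 * (q * C3)) => [|V e V0 e0].
  by apply: addr_ge0; [exact: (mulr_ge0 (ltW f0))
    |exact: (mulr_ge0 (ltW C10) (mulr_ge0 q0 (ltW C30)))].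
have e20 : 0 < e / 2 / f by rewrite (divr_gt0 _ f0)// divr_gt0.
have [m0 hm0] := hC2 V _ V0 e20.
exists m0 => m mm.
have w0 p : 0 < V + D p by rewrite ltr_wpDl// (lt_le_trans d0).
have dw p : d <= V + D p by rewrite (le_trans (dD p))// lerDr.
(* The number of rows. Each gets the error share [e / 2 / N], which is why the threshold for [n]
   depends on [m]. *)
pose N : R := (2 ^ m.+1)%:R.
have N0 : 0 < N by rewrite ltr0n expn_gt0.
have eN : 0 < e / 2 / N by rewrite !divr_gt0.
have [n0 hn0] := eventually_uniform (fun k : 'I_(2 ^ m.+1) =>
   hC1 (fun p => Y p + node Ly m k) (fun p => V + D p) dw _ eN).
exists n0 => n nn.
have := hm0 m mm; set g := \sum_(k < _) _ => hg.
pose G k := \sum_p Q p * ln ((Y p + node Ly m k) ^+ 2 + (V + D p) ^+ 2).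
set T := \sum_(k < _) _.
have Tg : `|T + f * g| <= C1 * (q * C3) * expR (- (c * V)) + e / 2.
  rewrite /T /g mulr_sumr -big_split /=.
  apply: le_trans (ler_norm_sum _ _ _) _.
  apply: (@le_trans _ _ (\sum_(k < 2 ^ m.+1) (C1 * \sum_p `|Q p| *
    (expR (- (c * V)) * (Num.sqrt (V + D p) / (V + D p + (Y p + node Ly m k) ^+ 2)))
    + e / 2 / N))).
    apply: ler_sum => k _; apply: le_trans (hn0 n nn k) _.
    rewrite lerD2r ler_pM2l//; apply: ler_sum => p _; rewrite ler_wpM2l//.
    rewrite ler_wpM2r//.
      by rewrite divr_ge0 ?sqrtr_ge0// addr_ge0 ?sqr_ge0// ltW.
    rewrite ler_expR lerN2; apply: (@le_trans _ _ (cx * V)).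
      by rewrite ler_wpM2r// ge_min lexx.
    by rewrite ler_pM2l// lerDl (le_trans _ (dD p))// ltW.
  rewrite big_split /= sumr_const card_ord -[X in _ + X]mulr_natr.
  rewrite divfK ?gt_eqF// lerD2r -mulr_sumr exchange_big /= -!mulrA ler_pM2l//.
  rewrite /q mulr_suml; apply: ler_sum => p _.
  rewrite -mulr_sumr ler_wpM2l// -mulr_sumr [leRHS]mulrC ler_pM2l ?expR_gt0//.
  have s0 : 0 < Num.sqrt (V + D p) by rewrite sqrtr_gt0.
  rewrite -mulr_sumr mulrC -ler_pdivlMr//.
  have sw : Num.sqrt d <= Num.sqrt (V + D p) by rewrite ler_wsqrtr.
  apply: le_trans (hC3 (Y p) m _ sw).
  by apply: ler_sum => k _; rewrite sqr_sqrtr ?(ltW (w0 p))// addrC.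
have fg : `|f * g| <= f * C2 * expR (- (c * V)) + e / 2.
  rewrite normrM (gtr0_norm f0); apply: (@le_trans _ _ (f * (C2 * expR (- (cy * V)) + e / 2 / f))).
    by rewrite ler_pM2l.
  rewrite mulrDr [f * (e / 2 / f)]mulrC divfK ?gt_eqF// lerD2r -[leRHS]mulrA ler_pM2l//.
  by rewrite ler_wpM2l// ler_expR lerN2 ler_wpM2r// ge_min lexx orbT.
have : `|T| <= `|T + f * g| + `|f * g|.
  by rewrite -[X in `|X| <= _](addrK (f * g)) ler_normB.
by rewrite [(_ + _ * (q * C3)) * _]mulrDl; lra.
Qed.

End neutral_lattice.

(** * Image charges *)

(* If the net of finite sums diverges, [lim] returns the default value [0], and the
   bound is trivial: summability need not be established. *)
Lemma lattice_sum_le (R : realType) (f : int * int -> R) (C : R) : 0 <= C ->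
  (forall e, 0 < e -> forall A : {fset int * int},
     exists2 J : {fset int * int}, {subset A <= J} & `|\sum_(n <- J) f n| <= C + e) ->
  `|lattice_sum f| <= C.
Proof.
move=> C0 hC; rewrite /lattice_sum /summability.sum.
have [cf|ncf] := pselect (cvg (summability.partial_sum (f : _ -> R^o) @ summability.totally)); last first.
  by rewrite (dvgP ncf) normr0.
apply/ler_addgt0Pr => e e0; have e20 : 0 < e / 2 by rewrite divr_gt0.
have FF : ProperFilter (@summability.totally (int * int)%type) :=
  summability.totally_filter.
have /cvgrPdist_le /(_ _ e20) [A _ hA] := cf.
have [J AJ hJ] := hC _ e20 A.
have AJ' : (A `<=` J)%fset by apply/fsubsetP => x /AJ.
have := hA J AJ'; rewrite /summability.partial_sum -(big_seq_fsetE _ _ predT f) /=.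
set s := lim _; set t := \sum_(_ <- _) _ in hJ *.
by have := ler_normD (s - t) t; rewrite subrK; lra.
Qed.

Definition box_index (m : nat) (k : nat) : int := k%:Z - (2 ^ m)%:Z.

(** Two independent sizes, since the first must be chosen after the second. *)
Definition box (n m : nat) : seq (int * int) :=
  [seq (box_index n l, box_index m k) | k : 'I_(2 ^ m.+1) <- index_enum 'I_(2 ^ m.+1),
                                       l : 'I_(2 ^ n.+1) <- index_enum 'I_(2 ^ n.+1)].

Lemma box_sum (R : realType) (n m : nat) (f : int * int -> R) :
  exists2 J : {fset int * int}, J =i box n m &
   \sum_(x <- J) f x =
   \sum_(k < 2 ^ m.+1) \sum_(l < 2 ^ n.+1) f (box_index n l, box_index m k).
Proof.
exists (seq_fset tt (box n m)); first exact: seq_fsetE.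
rewrite (perm_big _ (seq_fset_perm _ _)) undup_id /=; last first.
  apply: allpairs_uniq; rewrite ?index_enum_uniq//.
  move=> [k l] [k' l'] _ _ /= [/addIr[e1] /addIr[e2]].
  by congr (_, _); apply: val_inj.
by rewrite big_allpairs_dep.
Qed.

Lemma box_exhausts (A : {fset int * int}) : exists n0, forall n m,
  (n0 <= n)%N -> (n0 <= m)%N -> {subset A <= box n m}.
Proof.
pose M := (\max_(x <- A) maxn `|x.1| `|x.2|)%N.
exists M => n m Mn Mm x xA.
have xM : (maxn `|x.1| `|x.2| <= M)%N by
  exact: (@leq_bigmax_seq _ _ xpredT (fun x : int * int => maxn `|x.1| `|x.2|)).
have idx (r : nat) (z : int) : (`|z| <= r)%N -> exists2 k : 'I_(2 ^ r.+1), true & z = box_index r k.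
  move=> zr; have r2 : (r < 2 ^ r)%N by exact: ltn_expl.
  have kr : (`|(z + (2 ^ r)%:Z)%R| < 2 ^ r.+1)%N by rewrite expnS; lia.
  by exists (Ordinal kr) => //; rewrite /box_index /=; lia.
have [l _ e1] := idx n x.1 ltac:(lia).
have [k _ e2] := idx m x.2 ltac:(lia).
apply/allpairsP; exists (k, l); split; rewrite ?mem_index_enum//=.
by rewrite -e1 -e2 -surjective_pairing.
Qed.

(** Coordinate differences and sums of wall distances all have the form [g i + h j]; thus neutrality
    of the [q i] alone annihilates both the total and the first moments of the pair weights
    [q i * q j]. *)
Lemma pair_neutral_sum (R : realType) N (q g h : 'I_N -> R) : \sum_i q i = 0 ->
  \sum_(p : 'I_N * 'I_N) q p.1 * q p.2 * (g p.1 + h p.2) = 0.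
Proof.
move=> q0; rewrite -(pair_bigA _ (fun i j => q i * q j * (g i + h j))) /=.
have e i j : q i * q j * (g i + h j) = q j * (q i * g i) + q i * (q j * h j) by ring.
under eq_bigr => i _.
  under eq_bigr do rewrite e.
  rewrite big_split /= -mulr_suml q0 mul0r add0r -mulr_sumr; over.
by rewrite -mulr_suml q0 mul0r.
Qed.

(** The reciprocal of a sum replaces a minimum; the summand 1 covers an empty [P]. *)
Lemma finite_pos_lower_bound (R : realType) (P : finType) (D : P -> R) :
  (forall p, 0 < D p) -> exists2 d, 0 < d & forall p, d <= D p.
Proof.
move=> D0; have s0 : 0 <= \sum_p (D p)^-1 by rewrite sumr_ge0// => p _; rewrite invr_ge0 ltW.
exists (1 + \sum_p (D p)^-1)^-1 => [|p]; first by rewrite invr_gt0; lra.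
rewrite -[leRHS]invrK lef_pV2 ?posrE ?invr_gt0//; last by lra.
rewrite (bigD1 p)//=; have : 0 <= \sum_(i | i != p) (D i)^-1.
  by rewrite sumr_ge0// => i _; rewrite invr_ge0 ltW.
lra.
Qed.

Definition decay_rate (R : realType) N (S : sandwich R N) : R :=
  2 * pi / Num.max (Lx S) (Ly S).

Section image_charges.
Context {R : realType} {N : nat}.
Variable S : sandwich R N.
Hypotheses (Lx_gt0 : 0 < Lx S) (Ly_gt0 : 0 < Ly S) (H_gt0 : 0 < H S).
Hypothesis zpos_in : forall i : 'I_N, 0 < zpos S i < H S.
Hypothesis neutral : \sum_(i < N) qval S i = 0.

Notation kappa := (decay_rate S).

(* [z_i - z_j^(l)] has absolute value [(l - 1) * H] plus a distance from each of the
   two charges to one of the walls ([sqr_z_plus], [sqr_z_minus]). *)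
Definition wall_dist (top : bool) (i : 'I_N) : R :=
  if top then H S - zpos S i else zpos S i.

(** For order l, [V] is (l - 1) H. Otherwise the order enters through its parity only, so four pairs
    of walls cover all images and one constant serves every order. *)
Definition layer_sum (b b' : bool) (V : R) (n : int * int) : R := \sum_(i < N) \sum_(j < N)
  qval S i * qval S j / Num.sqrt ((xpos S i - xpos S j + n.1%:~R * Lx S) ^+ 2
          + (ypos S i - ypos S j + n.2%:~R * Ly S) ^+ 2
          + (V + (wall_dist b i + wall_dist b' j)) ^+ 2).

Lemma layer_sum_le : exists2 C, 0 <= C & forall b b' (V e : R), 0 <= V -> 0 < e ->
  exists m0, forall m, (m0 <= m)%N -> exists n0, forall n, (n0 <= n)%N ->
  `|\sum_(k < 2 ^ m.+1) \sum_(l < 2 ^ n.+1)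
      layer_sum b b' V (box_index n l, box_index m k)|
  <= C * expR (- (kappa * V)) + e.
Proof.
pose Q (p : 'I_N * 'I_N) := qval S p.1 * qval S p.2.
pose X (p : 'I_N * 'I_N) := xpos S p.1 - xpos S p.2.
pose Y (p : 'I_N * 'I_N) := ypos S p.1 - ypos S p.2.
pose D (b b' : bool) (p : 'I_N * 'I_N) := wall_dist b p.1 + wall_dist b' p.2.
have w0 b i : 0 < wall_dist b i.
  by rewrite /wall_dist; case: b; have := zpos_in i; rewrite ?subr_gt0 => /andP[].
have Q0 : \sum_p Q p = 0.
  rewrite -[RHS](pair_neutral_sum (fun=> 1) (fun=> 0) neutral).
  by apply: eq_bigr => p _; rewrite addr0 mulr1.
have QY0 : \sum_p Q p * Y p = 0 by exact: (pair_neutral_sum _ (fun j => - ypos S j) neutral).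
have QD0 b b' : \sum_p Q p * D b b' p = 0 by exact: pair_neutral_sum neutral.
have cx0 : 0 < 2 * pi / Lx S by rewrite divr_gt0// mulr_gt0// pi_gt0.
have cy0 : 0 < 2 * pi / Ly S by rewrite divr_gt0// mulr_gt0// pi_gt0.
have cxL : 2 * pi / Lx S * Lx S = 2 * pi by rewrite divfK// gt_eqF.
have cyL : 2 * pi / Ly S * Ly S = 2 * pi by rewrite divfK// gt_eqF.
have kappa_le : kappa <= Num.min (2 * pi / Lx S) (2 * pi / Ly S).
  have pi2 : 0 < 2 * pi :> R by rewrite mulr_gt0// pi_gt0.
  by rewrite le_min /decay_rate !ler_pM2l// !lef_pV2 ?posrE ?lt_max ?Lx_gt0// !le_max !lexx orbT.
have h (bb : bool * bool) : exists C, 0 <= C /\ forall (V e : R), 0 <= V -> 0 < e ->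
  exists m0, forall m, (m0 <= m)%N -> exists n0, forall n, (n0 <= n)%N ->
  `|\sum_(k < 2 ^ m.+1) \sum_(l < 2 ^ n.+1)
      layer_sum bb.1 bb.2 V (box_index n l, box_index m k)|
  <= C * expR (- (kappa * V)) + e.
  have D0 p : 0 < D bb.1 bb.2 p by rewrite addr_gt0.
  have [d d0 dD] := finite_pos_lower_bound D0.
  have [C C0 hC] := neutral_lattice_sum X d0 dD Q0 QY0 (QD0 bb.1 bb.2) cx0 cxL cy0 cyL.
  exists C; split=> // V e V0 e0; have [m0 hm0] := hC V e V0 e0.
  exists m0 => m /hm0[n0 hn0]; exists n0 => n nn.
  apply: (@le_trans _ _ (C * expR (- (Num.min (2 * pi / Lx S) (2 * pi / Ly S) * V)) + e)); last first.
    by rewrite lerD2r ler_wpM2l// ler_expR lerN2 ler_wpM2r.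
  apply: le_trans (hn0 n nn); rewrite le_eqVlt; apply/orP; left; apply/eqP.
  congr `|_|; apply: eq_bigr => k _; apply: eq_bigr => l _.
  rewrite /layer_sum (pair_bigA _ (fun i j => qval S i * qval S j /
    Num.sqrt (_ + _ + (V + (wall_dist bb.1 i + wall_dist bb.2 j)) ^+ 2))) /=.
  apply: eq_bigr => p _; rewrite /Q /X /Y /D /node /box_index /=.
  by rewrite !rmorphB /= -!natrX ![_ * Lx S]mulrC ![_ * Ly S]mulrC.
pose C bb := projT1 (cid (h bb)).
have C0 bb : 0 <= C bb by case: (projT2 (cid (h bb))).
exists (\sum_bb C bb) => [|b b' V e V0 e0]; first by rewrite sumr_ge0.
have [_ hC] := projT2 (cid (h (b, b'))).
have [m0 hm0] := hC V e V0 e0.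
exists m0 => m /hm0[n0 hn0]; exists n0 => n /hn0 /le_trans; apply.
rewrite lerD2r ler_wpM2r ?expR_ge0// -/(C (b, b')) (bigD1 (b, b'))//= lerDl.
by rewrite sumr_ge0.
Qed.

Lemma sqr_z_plus l (i j : 'I_N) : (zpos S i - z_plus S l.+1 j) ^+ 2 =
  (l%:R * H S + (wall_dist true i + wall_dist (odd l.+1) j)) ^+ 2.
Proof.
have := odd_double_half l; rewrite /z_plus -signr_odd /=; move: l./2 => h.
case: (odd l) => <-; rewrite ?add0n ?add1n /= ?uphalf_double ?doubleK -?natr1 -?mul2n ?natrM.
by ring.
by ring.
Qed.

Lemma sqr_z_minus l (i j : 'I_N) : (zpos S i - z_minus S l.+1 j) ^+ 2 =
  (l%:R * H S + (wall_dist false i + wall_dist (~~ odd l.+1) j)) ^+ 2.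
Proof.
have := odd_double_half l; rewrite /z_minus -signr_odd /=; move: l./2 => h.
case: (odd l) => <-; rewrite ?add0n ?add1n /= ?uphalf_double ?doubleK -?natr1 -?mul2n ?natrM.
by ring.
by ring.
Qed.
Lemma image_energy_le : exists2 C, 0 <= C & forall l,
  `|image_energy S l.+1| <=
    C * (`|gamma_plus S l.+1| + `|gamma_minus S l.+1|) * expR (- (kappa * H S)) ^+ l.
Proof.
have [C C0 hC] := layer_sum_le; exists C => // l.
set gp := gamma_plus S l.+1; set gm := gamma_minus S l.+1.
have E0 := expR_ge0 (- (kappa * H S)).
pose V := l%:R * H S.
have V0 : 0 <= V by rewrite mulr_ge0// ltW.
have -> : expR (- (kappa * H S)) ^+ l = expR (- (kappa * V)).
  by rewrite -expRM_natl /V; congr expR; ring.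
pose bp := (true, odd l.+1); pose bm := (false, ~~ odd l.+1).
apply: lattice_sum_le => [|e e0 A].
  by rewrite !mulr_ge0 ?addr_ge0 ?expR_ge0.
(* Splits the error between the two families, weighted by [gp] and [gm]; the 1 avoids dividing by 0
   when both vanish. *)
pose g := `|gp| + `|gm| + 1.
have g0 : 0 < g by rewrite ltr_wpDl// addr_ge0.
have eg : 0 < e / g by rewrite divr_gt0.
have [n0 hn0] := box_exhausts A.
have [m1 hm1] := hC bp.1 bp.2 V _ V0 eg.
have [m2 hm2] := hC bm.1 bm.2 V _ V0 eg.
(* A single box has to serve both image families and contain [A]. *)
pose m := maxn n0 (maxn m1 m2).
have [n1 hn1] := hm1 m ltac:(rewrite /m; lia).
have [n2 hn2] := hm2 m ltac:(rewrite /m; lia).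
pose n := maxn n0 (maxn n1 n2).
have [J JE Jsum] := box_sum n m (fun n => \sum_(i < N) \sum_(j < N)
    qval S i * qval S j *
    (gp / lattice_dist S n i j (z_plus S l.+1 j)
     + gm / lattice_dist S n i j (z_minus S l.+1 j))).
exists J => [x xA|].
  by rewrite JE; apply: hn0 xA; rewrite ?/n ?/m leq_max leqnn.
rewrite Jsum.
have := hn1 n ltac:(rewrite /n; lia); have := hn2 n ltac:(rewrite /n; lia).
set Tm := \sum_(k < _) _; set Tp := \sum_(k < _) _ => hm hp.
have -> : \sum_(k < 2 ^ m.+1) \sum_(l0 < 2 ^ n.+1) \sum_(i < N) \sum_(j < N)
    qval S i * qval S j *
    (gp / lattice_dist S (box_index n l0, box_index m k) i j (z_plus S l.+1 j)
     + gm / lattice_dist S (box_index n l0, box_index m k) i j (z_minus S l.+1 j))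
   = gp * Tp + gm * Tm.
  rewrite /Tp /Tm !mulr_sumr -big_split /=; apply: eq_bigr => k _.
  rewrite !mulr_sumr -big_split /=; apply: eq_bigr => l0 _.
  rewrite /layer_sum !mulr_sumr -big_split /=; apply: eq_bigr => i _.
  rewrite !mulr_sumr -big_split /=; apply: eq_bigr => j _.
  rewrite /lattice_dist sqr_z_plus sqr_z_minus /=.
  move: (Num.sqrt _)^-1 (Num.sqrt _)^-1 => a b; ring.
apply: le_trans (ler_normD _ _) _; rewrite (normrM gp) (normrM gm).
have h1 : `|gp| * `|Tp| <= `|gp| * (C * expR (- (kappa * V)) + e / g) by rewrite ler_wpM2l.
have h2 : `|gm| * `|Tm| <= `|gm| * (C * expR (- (kappa * V)) + e / g) by rewrite ler_wpM2l.
have h3 : (`|gp| + `|gm|) * (e / g) <= e.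
  by rewrite mulrCA ler_piMr ?(ltW e0)// ler_pdivrMr// mul1r /g lerDl.
move: h1 h2 h3; move: (e / g) (expR _) (`|Tp|) (`|Tm|) (`|gp|) (`|gm|) => x E a b u v.
lra.
Qed.

End image_charges.

(** * Tail of the reflection series *)

Lemma series_tail_le (R : realType) (u : nat -> R) (r K0 K : R) (M : nat) :
  0 < r < 1 -> (forall l, `|u l.+1| <= K0 * r ^+ l) ->
  (forall l, (M <= l)%N -> `|u l.+1| <= K * r ^+ l) ->
  `|\big[+%R/0]_(1 <= l <oo) u l - \sum_(1 <= l < M.+1) u l| <= K * r ^+ M / (1 - r).
Proof.
move=> /andP[r0 r1] hK0 hK.
have K00 : 0 <= K0 by rewrite -[K0]mulr1 -[1](expr0 r) (le_trans _ (hK0 0%N)).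
have KM : 0 <= K * r ^+ M by apply: le_trans (hK _ (leqnn M)).
(* The series starts at 1, and [u 0] is not controlled by the hypotheses. *)
pose v l := if l is 0%N then 0 else u l.
have Sv : (fun n => \sum_(1 <= l < n) u l) = series v.
  apply/funext => -[|n]; first by rewrite /series/= !big_geq.
  by rewrite /series/= [RHS]big_ltn// add0r; apply: eq_big_nat => -[|l].
(* [K0] serves convergence, without which the infinite sum would be a default value; the size of the
   tail comes from [K]. *)
have cv : cvgn (series v).
  apply: normed_cvg; apply: series_le_cvg (_ : cvgn (series (geometric (K0 / r) r))).
  - by move=> n; rewrite normr_ge0.
  - by move=> n; rewrite /geometric/= mulr_ge0 ?exprn_ge0 ?divr_ge0 ?(ltW r0).
  - move=> [|n]; rewrite /geometric /=; first by rewrite normr0 expr0 mulr1 divr_ge0// ltW.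
    by rewrite exprS mulrA divfK ?gt_eqF.
  - by apply: is_cvg_geometric_series; rewrite ger0_norm ?(ltW r0).
(* Keeping the exact geometric remainder closes the induction. *)
have tail n : (M.+1 <= n)%N ->
    `|\sum_(1 <= l < n) u l - \sum_(1 <= l < M.+1) u l|
    <= K * r ^+ M / (1 - r) - K * r ^+ n.-1 / (1 - r).
  elim: n => [//|n IH]; rewrite leq_eqVlt => /predU1P[<-|Mn].
    by rewrite !subrr normr0.
  rewrite big_nat_recr /=; last by lia.
  have := IH Mn; case: n Mn {IH} => [//|n] Mn /= IH.
  rewrite addrAC; apply: le_trans (ler_normD _ _) _.
  apply: le_trans (lerD IH (hK n _)) _; first by lia.
  rewrite exprS; set w := r ^+ n; set z := _ / _.
  have -> : K * (r * w) / (1 - r) = K * w / (1 - r) - K * w.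
    by field; rewrite subr_eq0 gt_eqF.
  lra.
have cl : \big[+%R/0]_(1 <= l <oo) u l = limn (series v) by rewrite -Sv.
rewrite cl; apply/ler_addgt0Pr => e e0.
have /cvgrPdist_le /(_ e e0) [n0 _ hn0] := cv.
pose n := maxn n0 M.+1.
have h1 := hn0 n (leq_maxl _ _); have h2 := tail n (leq_maxr _ _).
have h3 : 0 <= K * r ^+ n.-1 / (1 - r).
  rewrite divr_ge0 ?subr_ge0 ?(ltW r1)//.
  by apply: le_trans (normr_ge0 (u n.-1.+1)) (hK _ _); rewrite /n; lia.
have e1 : series v n = \sum_(1 <= l < n) u l by rewrite -Sv.
have := ler_distD (series v n) (limn (series v)) (\sum_(1 <= l < M.+1) u l).
rewrite {2}e1; move: h1 h2; rewrite /= => h1 h2; lra.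
Qed.

(* For odd [M.+1] the factor [gamma_plus] has one power of [gamma_bot] less than the
   right-hand side, hence the constant [`|gamma_bot S|^-1]; if [gamma_bot S = 0] it is
   [0], and both sides vanish since [M >= 1]. *)
Lemma gamma_factor_le (R : realType) N (S : sandwich R N) (M l : nat) :
  `|gamma_top S| <= 1 -> `|gamma_bot S| <= 1 -> (1 <= M)%N -> (M <= l)%N ->
  `|gamma_plus S l.+1| + `|gamma_minus S l.+1| <=
  (2 + `|gamma_bot S|^-1) * (`|gamma_top S| ^+ (M.+1)./2 * `|gamma_bot S| ^+ uphalf M.+1).
Proof.
rewrite /gamma_plus /gamma_minus !(normrM (_ ^+ _)) !normrX.
move: (`|gamma_top S|) (`|gamma_bot S|) (normr_ge0 (gamma_top S)) (normr_ge0 (gamma_bot S)).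
move=> a b a0 b0 a1 b1 M1 Ml.
set f := (M.+1)./2; set g := uphalf M.+1.
have fl : (f <= l.+1./2)%N by apply: half_leq.
have gl : (g <= uphalf l.+1)%N by apply: uphalf_leq.
have fg : (f <= g <= f.+1)%N by rewrite /f /g uphalf_half; lia.
have f0 : (0 < f)%N by rewrite /f; lia.
have pw (x : R) i j : 0 <= x -> x <= 1 -> (i <= j)%N -> x ^+ j <= x ^+ i.
  by move=> x0 x1 ij; rewrite ler_wiXn2l.
have G0 : 0 <= a ^+ f * b ^+ g by rewrite mulr_ge0 ?exprn_ge0.
have h1 : a ^+ l.+1./2 * b ^+ uphalf l.+1 <= a ^+ f * b ^+ g.
  by apply: ler_pM; rewrite ?exprn_ge0// pw.
have h2 : a ^+ uphalf l.+1 * b ^+ l.+1./2 <= a ^+ f * b ^+ f.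
  by apply: ler_pM; rewrite ?exprn_ge0// pw//; lia.
have h3 : a ^+ f * b ^+ f <= (1 + b^-1) * (a ^+ f * b ^+ g).
  rewrite mulrDl mul1r.
  have bG : 0 <= b^-1 * (a ^+ f * b ^+ g) by rewrite mulr_ge0// invr_ge0.
  have [gf|gf] : g = f \/ g = f.+1.
    have /andP[fg1] := fg; rewrite leq_eqVlt ltnS => /predU1P[|gf]; first by right.
    by left; apply/eqP; rewrite eqn_leq gf fg1.
    by rewrite gf; move: bG; rewrite gf; lra.
  have [bz|bz] := eqVneq b 0.
    have bf : b ^+ f = 0 by rewrite bz expr0n gtn_eqF.
    by rewrite bf mulr0 addr_ge0.
  have -> : a ^+ f * b ^+ f = b^-1 * (a ^+ f * b ^+ g) by rewrite gf exprS; field.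
  by rewrite lerDr.
have : 0 <= b^-1 by rewrite invr_ge0.
lra.
Qed.

Theorem theorem3p2 (R : realType) (N : nat) (S : sandwich R N)
    (Lx_gt0 : 0 < Lx S) (Ly_gt0 : 0 < Ly S) (H_gt0 : 0 < H S)
    (eps_top_neq : eps_c S + eps_top S != 0)
    (eps_bot_neq : eps_c S + eps_bot S != 0)
    (gamma_top_le1 : `|gamma_top S| <= 1)
    (gamma_bot_le1 : `|gamma_bot S| <= 1)
    (zpos_in : forall i : 'I_N, 0 < zpos S i < H S)
    (neutral : \sum_(i < N) qval S i = 0) :
  (fun M : nat => `|energy S - truncated_energy S M| : R^o) =O_\oo
  (fun M : nat =>
     `|gamma_top S| ^+ (M.+1)./2 * `|gamma_bot S| ^+ uphalf M.+1
     * expR (- (2 * pi * H S * (M%:R - 1) / Num.max (Lx S) (Ly S))) : R^o).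
Proof.
have [C C0 hC] := image_energy_le Lx_gt0 Ly_gt0 H_gt0 zpos_in neutral.
set r := expR (- (decay_rate S * H S)) in hC.
have mx0 : 0 < Num.max (Lx S) (Ly S) by rewrite lt_max Lx_gt0.
have r01 : 0 < r < 1.
  by rewrite /r expR_gt0 expR_lt1 oppr_lt0 mulr_gt0// divr_gt0// mulr_gt0// pi_gt0.
have [r0 r1] := andP r01.
pose A := 2 + `|gamma_bot S|^-1.
have A0 : 0 < A by rewrite ltr_pwDl// invr_ge0.
(* [A] stems from [gamma_factor_le], [1 - r] from the geometric series; the 1 keeps the constant
   positive if [C = 0]. *)
apply/eqO_exP; exists (C * A / (1 - r) + 1).
  by rewrite ltr_wpDl// !mulr_ge0 ?invr_ge0 ?subr_ge0// ltW.
exists 1%N => // M /= M1.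
pose G := `|gamma_top S| ^+ (M.+1)./2 * `|gamma_bot S| ^+ uphalf M.+1.
have G0 : 0 <= G by rewrite mulr_ge0 ?exprn_ge0.
have -> : expR (- (2 * pi * H S * (M%:R - 1) / Num.max (Lx S) (Ly S))) = r ^+ M.-1.
  have -> : M%:R - 1 = M.-1%:R :> R by rewrite -[in LHS](prednK M1) -natr1 addrK.
  by rewrite /r -expRM_natl /decay_rate; congr expR; ring.
rewrite normr_id (ger0_norm (mulr_ge0 G0 (exprn_ge0 _ (ltW r0)))) -/G.
have -> : energy S - truncated_energy S M = 2^-1 *
   (\big[+%R/0]_(1 <= l <oo) image_energy S l - \sum_(1 <= l < M.+1) image_energy S l).
  by rewrite /energy /truncated_energy; ring.
have gle (x y : R) i j : `|x| <= 1 -> `|y| <= 1 -> `|x ^+ i * y ^+ j| <= 1.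
  by move=> x1 y1; rewrite normrM !normrX mulr_ile1 ?exprn_ge0// exprn_ile1.
have tail := @series_tail_le R (image_energy S) r (C * 2) (C * A * G) M r01.
rewrite normrM ger0_norm ?invr_ge0//.
have : `|\big[+%R/0]_(1 <= l <oo) image_energy S l - \sum_(1 <= l < M.+1) image_energy S l|
    <= C * A * G * r ^+ M / (1 - r).
  apply: tail => [l|l Ml]; apply: le_trans (hC l) _.
    rewrite ler_wpM2r ?exprn_ge0 ?(ltW r0)// ler_wpM2l//.
    by rewrite -[2]/(1 + 1) lerD// gle.
  rewrite ler_wpM2r ?exprn_ge0 ?(ltW r0)// -mulrA ler_wpM2l//.
  exact: gamma_factor_le.
(* The first omitted order is [M.+1], which contributes [r ^+ M]: one factor [r < 1] better than the
   claim, dropped below. *)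
rewrite -{2}(prednK M1) exprS.
set T := `|_| => hT; have T0 : 0 <= T by rewrite normr_ge0.
have w0 : 0 <= r ^+ M.-1 by rewrite exprn_ge0// ltW.
move: (r ^+ M.-1) w0 hT => w w0 hT.
have Gw : 0 <= G * w by rewrite mulr_ge0.
have K0 : 0 <= C * A / (1 - r) by rewrite !mulr_ge0 ?invr_ge0 ?subr_ge0// ltW.
have e1 : C * A * G * (r * w) / (1 - r) = C * A / (1 - r) * (G * w) * r by ring.
have h2 : C * A / (1 - r) * (G * w) * r <= C * A / (1 - r) * (G * w).
  by rewrite (ler_piMr (mulr_ge0 K0 Gw))// ltW.
rewrite mulrDl mul1r; lra.
Qed.
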